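(* Let $\{(\phi^n,v^n)\}_{n=0}^{N}$ and $\{\eta^{n-\frac12}\}_{n=1}^{N}$ satisfy the CN-SAV time-stepping scheme: for $1\leq n\leq N$, $$(\partial_{\tau}^{\alpha}\phi)^{n-\frac12}=-\lambda\left(-\varepsilon^{2}\Delta\phi^{n-\frac12}+\beta\phi^{n-\frac12}+V(\hat{\phi}^{n-\frac12})v^{n-\frac12}-\eta^{n-\frac12}\right),$$ $$\eta^{n-\frac12}=\frac{1}{|\Omega|}\int_{\Omega}\left(-\varepsilon^{2}\Delta\phi^{n-\frac12}+\beta\phi^{n-\frac12}+V(\hat{\phi}^{n-\frac12})v^{n-\frac12}\right)\mathrm{d}\mathbf{x},$$ $$\partial_{\tau}v^{n-\frac12}=\frac12\int_{\Omega}V(\hat{\phi}^{n-\frac12})\,\partial_{\tau}\phi^{n-\frac12}\,\mathrm{d}\mathbf{x}.$$ Define the discrete energy $$E[\phi^{n},v^{n}]=\int_{\Omega}\left(\frac{\varepsilon^{2}}{2}|\nabla\phi^{n}|^{2}+\frac{\beta}{2}|\phi^{n}|^{2}\right)\mathrm{d}\mathbf{x}+(v^{n})^{2}-C_{0}-\left(\frac{\beta}{2}+\frac{\beta^{2}}{4}\right)|\Omega|.$$ Then, with no restriction on the time steps (unconditional energy stability), the scheme preserves the energy dissipation law $$E[\phi^{n},v^{n}]-E[\phi^{0},v^{0}]\leq0\quad\text{for } 1\leq n\leq N.$$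
   Context: Parameters: $0<\alpha<1$, $\lambda>0$ (mobility), $\varepsilon>0$ (interface width), $\beta$ a real regularization parameter, $C_0>0$ a constant. $\Omega\subset\mathbb{R}^d$ is a bounded rectangular domain with periodic boundary conditions, and $|\Omega|$ is its measure. The scheme is discrete in time only; the functions $\phi^n:\Omega\to\mathbb{R}$ are $\Omega$-periodic and sufficiently smooth in space for all expressions (and integration by parts) to make sense, while $v^n\in\mathbb{R}$ and $\eta^{n-\frac12}\in\mathbb{R}$ are scalars (constant in space). For a function $\phi$ on $\Omega$, $$V(\phi):=\frac{(\phi^{2}-1-\beta)\phi}{\sqrt{\int_{\Omega}\frac14(\phi^{2}-1-\beta)^{2}\,\mathrm{d}\mathbf{x}+C_{0}}}.$$ Time mesh: arbitrary nonuniform levels $0=t_0<t_1<\cdots<t_N=T$, steps $\tau_k:=t_k-t_{k-1}$, local step ratios $\rho_k:=\tau_k/\tau_{k+1}$. For a sequence $\{w^k\}$: $\triangledown_\tau w^k:=w^k-w^{k-1}$, $\partial_\tau w^{k-\frac12}:=\triangledown_\tau w^k/\tau_k$, $w^{k-\frac12}:=(w^k+w^{k-1})/2$ for $k\geq1$. L1$^+$ formula (approximating the Caputo derivative of order $\alpha$): $$(\partial_\tau^\alpha w)^{n-\frac12}:=\sum_{k=1}^n a_{n-k}^{(n)}\triangledown_\tau w^k,\qquad a_{n-k}^{(n)}:=\frac{1}{\tau_n\tau_k}\int_{t_{n-1}}^{t_n}\int_{t_{k-1}}^{\min\{t,t_k\}}\omega_{1-\alpha}(t-s)\,\mathrm{d}s\,\mathrm{d}t\quad(1\leq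 k\leq n),$$ where $\omega_{\mu}(t):=t^{\mu-1}/\Gamma(\mu)$. Extrapolation: $\hat\phi^{n-\frac12}:=\phi^{n-1}+\triangledown_\tau\phi^{n-1}/(2\rho_{n-1})$ for $n\geq2$; for $n=1$, $\hat\phi^{\frac12}$ is a prescribed smooth $\Omega$-periodic function (for instance $\phi^0$). Initial data: $\phi^0=\phi_0$ is given and $v^0=\sqrt{\int_{\Omega}\frac14(\phi_0^{2}-1-\beta)^{2}\,\mathrm{d}\mathbf{x}+C_{0}}$. *)

(* Defs.v *)
From HB Require Import structures.
From mathcomp Require Import all_boot all_order all_algebra.
From mathcomp Require Import all_classical all_reals all_analysis.
Set Implicit Arguments.
Unset Strict Implicit.
Unset Printing Implicit Defensive.
Import Order.TTheory GRing.Theory Num.Theory.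
Import numFieldNormedType.Exports.
Local Open Scope classical_set_scope.
Local Open Scope ring_scope.

(* Lebesgue measure on R^n, carried by n.-tuple R (whose sigma-algebra is
   generated by the coordinates): the n-fold product of the Lebesgue measure on
   the line, transported from R * R^n to R^n.+1 by (s, x) |-> s :: x. *)
Section lebesgue_tuple.
Variable R : realType.
Local Notation RT := (measurableTypeR R).

Definition tuple_cons n (p : RT * n.-tuple RT) : n.+1.-tuple RT :=
  [tuple of p.1 :: p.2].

Definition tuple_uncons n (x : n.+1.-tuple RT) : RT * n.-tuple RT :=
  (thead x, [tuple of behead x]).

Lemma measurable_tuple_cons n : measurable_fun setT (@tuple_cons n).
Proof. exact: (measurable_cons measurable_fst measurable_snd). Qed.

Lemma measurable_tuple_uncons n : measurable_fun setT (@tuple_uncons n).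
Proof.
apply/measurable_fun_pairP; split; first exact: measurable_tnth.
exact: measurable_behead.
Qed.

Lemma tuple_consK n : cancel (@tuple_cons n) (@tuple_uncons n).
Proof. by case=> s x; congr (_, _); apply/val_inj. Qed.

Lemma tuple_unconsK n : cancel (@tuple_uncons n) (@tuple_cons n).
Proof. by move=> x; rewrite [RHS]tuple_eta; apply/val_inj. Qed.

Section step.
Variables (n : nat) (m : {sigma_finite_measure set (n.-tuple RT) -> \bar R}).

Definition lebesgue_cons : set (n.+1.-tuple RT) -> \bar R :=
  pushforward (@lebesgue_measure R \x m)%E (@tuple_cons n).

Let lebesgue_cons0 : lebesgue_cons set0 = 0%E.
Proof. by rewrite /lebesgue_cons /pushforward preimage_set0 measure0. Qed.

Let lebesgue_cons_ge0 A : (0 <= lebesgue_cons A)%E.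
Proof. by apply: measure_ge0; exact: measurable_tuple_cons. Qed.

Let lebesgue_cons_sigma_additive : semi_sigma_additive lebesgue_cons.
Proof.
apply: measure_semi_sigma_additive; exact: measurable_tuple_cons.
Qed.

HB.instance Definition _ := isMeasure.Build _ _ _ lebesgue_cons
  lebesgue_cons0 lebesgue_cons_ge0 lebesgue_cons_sigma_additive.

Let lebesgue_cons_sigma_finite : sigma_finite setT lebesgue_cons.
Proof.
have /sigma_finiteP[F [TF ndF Foo]] := sigma_finiteT (@lebesgue_measure R).
have /sigma_finiteP[G [TG ndG Goo]] := sigma_finiteT m.
exists (fun i => @tuple_uncons n @^-1` (F i `*` G i)).
  apply/esym/seteqP; split=> // x _; rewrite -preimage_bigcup /preimage/=.
  have [i _ Fi] : (\bigcup_i F i) (thead x) by rewrite -TF.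
  have [j _ Gj] : (\bigcup_i G i) [tuple of behead x] by rewrite -TG.
  exists (maxn i j) => //; split => /=.
    by move: Fi; exact/subsetPset/ndF/leq_maxl.
  by move: Gj; exact/subsetPset/ndG/leq_maxr.
move=> i; have [mF Foo_i] := Foo i; have [mG Goo_i] := Goo i; split.
  rewrite -[X in measurable X]setTI.
  by apply: measurable_tuple_uncons => //; exact: measurableX.
rewrite /lebesgue_cons /pushforward -comp_preimage.
rewrite (_ : _ \o _ = id) ?preimage_id; last first.
  by apply/funext => p; exact: tuple_consK.
by rewrite product_measure1E// lte_mul_pinfty// ge0_fin_numE.
Qed.

HB.instance Definition _ :=
  Measure_isSigmaFinite.Build _ _ _ lebesgue_cons lebesgue_cons_sigma_finite.

End step.

Fixpoint lebesgue_tuple n : {sigma_finite_measure set (n.-tuple RT) -> \bar R} :=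
  if n is n'.+1 then lebesgue_cons (lebesgue_tuple n')
  else \d_([tuple] : 0.-tuple RT).

End lebesgue_tuple.

Section calculus.
Variables (R : realType) (d : nat).
Implicit Types (a b x : 'rV[R]_d) (f : 'rV[R]_d -> R).

Definition rect a b : set 'rV[R]_d := [set x | forall i, a 0 i < x 0 i < b 0 i].

Definition row_of_tuple (p : d.-tuple (measurableTypeR R)) : 'rV[R]_d :=
  \row_i tnth p i.

Definition rect_int a b f : R :=
  \int[lebesgue_tuple R d]_(p in row_of_tuple @^-1` rect a b)
    f (row_of_tuple p).

Definition rect_measure a b : R :=
  fine (lebesgue_tuple R d (row_of_tuple @^-1` rect a b)).

Definition partial (i : 'I_d) f : 'rV[R]_d -> R := 'D_(delta_mx 0 i) f.

(* The norm of 'rV[R]_d in the library is the sup norm, hence the explicit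
   Euclidean square. *)
Definition grad_sqnorm f x : R := \sum_(i < d) partial i f x ^+ 2.

Definition laplacian f x : R := \sum_(i < d) partial i (partial i f) x.

Definition C2 f : Prop :=
  [/\ continuous f,
      forall i, (forall x, derivable f x (delta_mx 0 i)) /\
                continuous (partial i f) &
      forall i j, (forall x, derivable (partial i f) x (delta_mx 0 j)) /\
                  continuous (partial j (partial i f))].

Definition rect_periodic a b f : Prop :=
  forall i x, f (x + (b 0 i - a 0 i) *: delta_mx 0 i) = f x.

End calculus.

Section time_discretization.
Variable R : realType.
Implicit Types (t w : nat -> R).
Local Notation leb := (@lebesgue_measure R).

Definition time_mesh (N : nat) (T : R) t : Prop :=
  [/\ t 0%N = 0, t N = T & forall k, (k < N)%N -> t k < t k.+1].

Definition tau t k : R := t k - t k.-1.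

Definition rho t k : R := tau t k / tau t k.+1.

Definition nabla w k : R := w k - w k.-1.

(* Half-integer superscripts are encoded by rounding up: the value at index n of
   [dtau], [mid], [L1plus], [extrapolation] is the one at level n - 1/2. *)
Definition dtau t w n : R := nabla w n / tau t n.

Definition mid w n : R := (w n + w n.-1) / 2.

Definition Gamma (z : R) : R :=
  \int[leb]_(s in `]0%R, +oo[) (s `^ (z - 1) * expR (- s)).

Definition omega (mu s : R) : R := s `^ (mu - 1) / Gamma mu.

(* The coefficient written a_{n-k}^{(n)}, indexed here by n and k. *)
Definition L1plus_coef (alpha : R) t (n k : nat) : R :=
  (tau t n * tau t k)^-1 *
  \int[leb]_(r in `[t n.-1, t n])
    (\int[leb]_(s in `[t k.-1, Num.min r (t k)]) omega (1 - alpha) (r - s)).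

Definition L1plus (alpha : R) t w n : R :=
  \sum_(1 <= k < n.+1) L1plus_coef alpha t n k * nabla w k.

Definition extrapolation (X : Type) t (phihat1 : X -> R) (phi : nat -> X -> R)
    (n : nat) (x : X) : R :=
  if (n <= 1)%N then phihat1 x
  else phi n.-1 x + nabla (phi ^~ x) n.-1 / (2 * rho t n.-1).

End time_discretization.

Section SAV.
Variables (R : realType) (d : nat).
Variables (a b : 'rV[R]_d) (eps beta C0 : R).
Implicit Types (f : 'rV[R]_d -> R) (phi : nat -> 'rV[R]_d -> R).

Definition SAV_aux f : R :=
  Num.sqrt (rect_int a b (fun x => 4^-1 * (f x ^+ 2 - 1 - beta) ^+ 2) + C0).

Definition SAV_V f (x : 'rV[R]_d) : R :=
  (f x ^+ 2 - 1 - beta) * f x / SAV_aux f.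

(* - eps^2 Delta phi^{n-1/2} + beta phi^{n-1/2} + V(phihat^{n-1/2}) v^{n-1/2},
   where fhat is phihat^{n-1/2}. *)
Definition SAV_potential phi (v : nat -> R) fhat (n : nat) (x : 'rV[R]_d) : R :=
  let phin := fun y => mid (phi ^~ y) n in
  - eps ^+ 2 * laplacian phin x + beta * phin x + SAV_V fhat x * mid v n.

Definition SAV_energy f (v : R) : R :=
  rect_int a b (fun x => eps ^+ 2 / 2 * grad_sqnorm f x + beta / 2 * f x ^+ 2)
  + v ^+ 2 - C0 - (beta / 2 + beta ^+ 2 / 4) * rect_measure a b.

End SAV.

(* Main.v *)
Require Import Defs.
From mathcomp Require Import all_boot all_order all_algebra.
From mathcomp Require Import all_classical all_reals all_analysis.
From mathcomp Require Import measurable_realfun ring lra.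
Import Order.TTheory GRing.Theory Num.Theory.
Import numFieldNormedType.Exports.
Local Open Scope classical_set_scope.
Local Open Scope ring_scope.

(** The scheme dissipates energy because the L1+ formula is of positive type.
Testing the first equation against the increment [nabla phi n] and the update of
[v] against the average of [v] turns every term into a difference of squares
([SAV_energy_increment], whose gradient part is Green's identity
[rect_int_laplacian_mul] on a periodic box).  The multiplier [eta] drops out
because the increments have mean zero: the definition of [eta] gives the discrete
fractional derivative mean zero, and this passes to the increments by induction on
the level since the diagonal coefficient is positive ([L1plus_coef_diag_gt0]).
Summing over the levels, the energy changes by [- lambda^-1] times the space
integral of the quadratic form of the L1+ coefficients evaluated at the increments.

That form is nonnegative at every point of space ([L1plus_form_ge0]).  By two
explicit integrations its coefficients are, up to a positive constant, mixed
second differences of [`|t i - t j| `^ (2 - alpha)] divided by the two time steps,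
with half of the diagonal.  For [0 < q < 2] the power [`|x| `^ q] is a
superposition, with positive weights, of [1 - cos (p * x)] over all [p > 0]
([integral_spectrum]); each frequency contributes the sum of the squares of a
cosine and a sine sum ([power_form_ge0]).  This works on an arbitrary mesh, so no
condition on the steps appears.

The calculus on the box rests on the recursive construction of its measure: a
continuous function is integrable there and its integral is an iterated one
([rect_int_cons], [rect_int_cons_swap]), hence the integral of a partial
derivative of a periodic function vanishes ([rect_int_partial_periodic]). *)

Set Implicit Arguments.
Unset Strict Implicit.
Unset Printing Implicit Defensive.

(** * Integrals of powers and exponentials *)

(** Continuity of the integrand is asked on the open interval only, so that
integrable endpoint singularities such as that of [x `^ (- al)] at [0] are
covered: the usual theorem applies on a growing sequence of compact
subintervals, and monotone convergence passes to the limit. *)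
Lemma ge0_singular_FTC2 (R : realType) (f F : R -> R) (a b : R) :
  a < b ->
  (forall x, a < x < b -> 0 <= f x) ->
  (forall x, a < x < b -> {for x, continuous f}) ->
  continuous F ->
  (forall x, a < x < b -> is_derive x 1 F (f x)) ->
  (\int[@lebesgue_measure R]_(x in `[a, b]) (f x)%:E = (F b - F a)%:E)%E.
Proof.
move=> ab f0 cf cF dF.
have mf : measurable_fun `]a, b[ f.
  apply: open_continuous_measurable_fun; first exact: interval_open.
  by move=> x; rewrite inE/= in_itv/=; exact: cf.
rewrite (@integral_itv_bndoo R a b (EFin \o f) true false);
  last exact/measurable_EFinP.
(* The factor 1/3 keeps the two shrunk endpoints apart already at n = 0. *)
pose h (n : nat) : R := (b - a) / 3 * harmonic n.
have ba0 : 0 < b - a by rewrite subr_gt0.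
have h_gt0 n : 0 < h n by rewrite !mulr_gt0// invr_gt0 ltr0n.
have h_le n : h n <= (b - a) / 3.
  rewrite /h ler_piMr//; first by rewrite divr_ge0 ?ltW.
  by rewrite invf_le1 ?ltr0n// ler1n.
have hcvg : h n @[n --> \oo] --> (0 : R).
  rewrite -(mulr0 ((b - a) / 3)); apply: cvgMl_tmp; exact: cvg_harmonic.
have h_noninc m n : (m <= n)%N -> h n <= h m.
  move=> mn; rewrite /h ler_pM2l ?divr_gt0//.
  by rewrite lef_pV2 ?posrE ?ltr0n// ler_nat.
pose A n : set R := `[a + h n, b - h n]%classic.
have Aoo n x : A n x -> a < x < b.
  rewrite /A/= in_itv/= => /andP[ax xb]; have hn := h_gt0 n; apply/andP; split; lra.
have Acup : \bigcup_n A n = `]a, b[%classic.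
  apply/seteqP; split => [x [n _ /Aoo]|x /=]; first by rewrite /= in_itv.
  rewrite in_itv/= => /andP[ax xb].
  pose e := Num.min (x - a) (b - x).
  have e0 : 0 < e by rewrite lt_min !subr_gt0 ax xb.
  have /cvgrPdist_lt/(_ _ e0)[n _ /(_ n (leqnn n))] := hcvg.
  rewrite /= sub0r normrN gtr0_norm ?h_gt0// lt_min => /andP[h1 h2].
  by exists n => //; rewrite /A/= in_itv/=; apply/andP; split; lra.
have Aint n : (\int[@lebesgue_measure R]_(x in A n) (f x)%:E
    = (F (b - h n) - F (a + h n))%:E)%E.
  have hab : a + h n < b - h n by have := h_le n; lra.
  rewrite /A (continuous_FTC2 (F := F) hab) ?EFinB//.
  - apply: continuous_in_subspaceT => x; rewrite inE => /Aoo; exact: cf.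
  - split; [|exact/cvg_at_right_filter/cF|exact/cvg_at_left_filter/cF].
    move=> x xab; have /dF[] // : a < x < b.
    by apply: (Aoo n); apply: subset_itv_oo_cc xab.
  - move=> x xab; rewrite derive1E; have /dF ? : a < x < b.
      by apply: (Aoo n); apply: subset_itv_oo_cc xab.
    by rewrite derive_val.
have ndA : nondecreasing_seq A.
  move=> m n mn; rewrite subsetEset => x; rewrite /A/= !in_itv/=.
  by have := h_noninc _ _ mn => hh /andP[? ?]; apply/andP; split; lra.
have cA := @ge0_nondecreasing_set_cvg_integral _ (measurableTypeR R) R A (EFin \o f)
  (@lebesgue_measure R) ndA.
rewrite -Acup; apply: (cvg_unique _ (cA _ _ _)).
- exact: ereal_hausdorff.
- by move=> n; exact: measurable_itv.
- move=> n; apply/measurable_EFinP; apply: measurable_funS mf => //.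
  by move=> x /Aoo; rewrite /= in_itv.
- by move=> n x /Aoo xab; rewrite lee_fin f0.
- rewrite /=; under eq_cvg do rewrite Aint.
  apply: cvg_EFin; first by near=> n.
  apply: cvgB.
    apply: continuous_cvg; first exact: cF.
    by rewrite -[X in _ --> X]subr0; apply: cvgB => //; exact: cvg_cst.
  apply: continuous_cvg; first exact: cF.
  by rewrite -[X in _ --> X]addr0; apply: cvgD => //; exact: cvg_cst.
Unshelve. all: by end_near. Qed.

Lemma derivable1_continuous (R : realType) (f : R -> R) (x : R) :
  derivable f x 1 -> {for x, continuous f}.
Proof. by move=> /derivable1_diffP/differentiable_continuous. Qed.

(** The absolute value makes the power a continuous function of the whole line,
as the antiderivatives below are required to be. *)
Lemma continuous_norm_powR (R : realType) (p : R) :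
  0 < p -> continuous (fun x : R => `|x| `^ p).
Proof.
move=> p0 x; have [->|x0] := eqVneq x 0.
  apply/cvgrPdist_lt => e e0; rewrite normr0 powR0 ?gt_eqF//.
  have d0 : 0 < e `^ p^-1 by rewrite powR_gt0.
  near=> y; rewrite sub0r normrN ger0_norm ?powR_ge0//.
  have -> : e = (e `^ p^-1) `^ p.
    by rewrite -powRrM mulVf ?gt_eqF// powRr1 ?ltW.
  apply: gt0_ltr_powR => //; rewrite ?nnegrE ?powR_ge0//.
have nx : 0 < `|x| by rewrite normr_gt0.
have cn : `|y| @[y --> x] --> `|x| by exact: (@norm_continuous _ R^o).
have cp : {for `|x|, continuous (@powR R ^~ p)}.
  apply: derivable1_continuous.
  by apply: derivable_powR; rewrite in_itv/= andbT.
exact: (cvg_comp _ _ cn cp).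
Unshelve. all: by end_near. Qed.
Lemma is_derive_powR_shift (R : realType) (q c x : R) :
  c < x -> is_derive x 1 (fun y => (y - c) `^ q) (q * (x - c) `^ (q - 1)).
Proof.
move=> cx; have xc : 0 < x - c by rewrite subr_gt0.
have dB : is_derive x 1 (fun y : R => y - c) 1.
  exact: (is_derive_shift x 1 (- c)).
have := @is_derive1_comp R (@powR R ^~ q) (fun y => y - c) x _ _
  (is_derive1_powR q xc) dB.
by rewrite mulr1.
Qed.

Lemma is_derive_powR_reflect (R : realType) (q c x : R) :
  x < c -> is_derive x 1 (fun y => (c - y) `^ q) (- (q * (c - x) `^ (q - 1))).
Proof.
move=> cx; have xc : 0 < c - x by rewrite subr_gt0.
have dB : is_derive x 1 (fun y : R => c - y) (-1).
  have := is_deriveB (is_derive_cst c x 1) (is_derive_id x (1 : R)).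
  by rewrite sub0r.
have := @is_derive1_comp R (@powR R ^~ q) (fun y => c - y) x _ _
  (is_derive1_powR q xc) dB.
by rewrite mulrN1.
Qed.

Lemma integral_powR_right (R : realType) (p c a b : R) :
  -1 < p -> c <= a -> a < b ->
  (\int[@lebesgue_measure R]_(x in `[a, b]) ((x - c) `^ p)%:E =
    (((b - c) `^ (p + 1) - (a - c) `^ (p + 1)) / (p + 1))%:E)%E.
Proof.
move=> p1 ca ab; have p10 : 0 < p + 1 by rewrite -ltrBlDr sub0r.
have pos x : a < x < b -> c < x by move=> /andP[? _]; lra.
pose F x := (p + 1)^-1 * `|x - c| `^ (p + 1).
apply: (etrans (@ge0_singular_FTC2 R _ F a b ab _ _ _ _)); rewrite /F.
- by move=> x _; exact: powR_ge0.
- move=> x /pos xc; apply: derivable1_continuous.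
  by have [] := @is_derive_powR_shift _ p c x xc.
- move=> x; apply: cvgMl_tmp.
  apply: (@continuous_comp _ _ _ (fun y : R => y - c) (fun y => `|y| `^ (p + 1))).
    by apply: cvgB => //; exact: cvg_cst.
  exact: continuous_norm_powR.
- move=> x /pos xc.
  apply: (@near_eq_is_derive _ R^o R^o (fun x => (p + 1)^-1 * (x - c) `^ (p + 1))).
    near=> y; rewrite ger0_norm// subr_ge0 ltW//; near: y; exact: lt_nbhsr.
  have := is_deriveZ (p + 1)^-1
    (@is_derive_powR_shift _ (p + 1) c x xc).
  rewrite addrK /GRing.scale/= mulrA mulVf ?gt_eqF//.
  by rewrite mul1r.
- by rewrite -mulrBr mulrC !ger0_norm// subr_ge0// (le_trans ca) ?ltW.
Unshelve. all: by end_near. Qed.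

Lemma integral_powR_left (R : realType) (p c a b : R) :
  -1 < p -> a < b -> b <= c ->
  (\int[@lebesgue_measure R]_(x in `[a, b]) ((c - x) `^ p)%:E =
    (((c - a) `^ (p + 1) - (c - b) `^ (p + 1)) / (p + 1))%:E)%E.
Proof.
move=> p1 ab bc; have p10 : 0 < p + 1 by rewrite -ltrBlDr sub0r.
have pos x : a < x < b -> x < c by move=> /andP[_ ?]; lra.
pose F x := - (p + 1)^-1 * `|c - x| `^ (p + 1).
apply: (etrans (@ge0_singular_FTC2 R _ F a b ab _ _ _ _)); rewrite /F.
- by move=> x _; exact: powR_ge0.
- move=> x /pos xc; apply: derivable1_continuous.
  by have [] := @is_derive_powR_reflect _ p c x xc.
- move=> x; apply: cvgMl_tmp.
  apply: (@continuous_comp _ _ _ (fun y : R => c - y) (fun y => `|y| `^ (p + 1))).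
    by apply: cvgB => //; exact: cvg_cst.
  exact: continuous_norm_powR.
- move=> x /pos xc.
  apply: (@near_eq_is_derive _ R^o R^o (fun x => - (p + 1)^-1 * (c - x) `^ (p + 1))).
    near=> y; rewrite ger0_norm// subr_ge0 ltW//; near: y; exact: lt_nbhsl.
  have := is_deriveZ (- (p + 1)^-1) (@is_derive_powR_reflect _ (p + 1) c x xc).
  rewrite addrK /GRing.scale/= mulNr mulrN opprK mulrA mulVf ?gt_eqF//.
  by rewrite mul1r.
- rewrite !ger0_norm ?subr_ge0// ?(le_trans _ bc) ?ltW//.
  by congr EFin; ring.
Unshelve. all: by end_near. Qed.

Lemma Rintegral_gt0 (R : realType) (D : set R) (f : R -> R) (a b m : R) :
  measurable D -> (@lebesgue_measure R).-integrable D (EFin \o f) ->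
  (forall x, D x -> 0 <= f x) ->
  a < b -> `[a, b]%classic `<=` D -> 0 < m ->
  (forall x, a <= x <= b -> m <= f x) ->
  0 < \int[@lebesgue_measure R]_(x in D) f x.
Proof.
move=> mD intf f0 ab abD m0 mf.
apply: (@lt_le_trans _ _ (m * (b - a))); first by rewrite mulr_gt0 ?subr_gt0.
rewrite -lee_fin fineK; last exact: integrable_fin_num.
have mfD : measurable_fun D (EFin \o f) by move/integrableP : intf => [].
apply: (@le_trans _ _ (\int[@lebesgue_measure R]_(x in `[a, b]) (f x)%:E)%E).
  apply: (@le_trans _ _ (\int[@lebesgue_measure R]_(x in `[a, b]) m%:E)%E).
    rewrite integral_cst//= lebesgue_measure_itv/= lte_fin ab -EFinD.
    by rewrite -EFinM.
  apply: ge0_le_integral => //=.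
  - by move=> x _; rewrite lee_fin ltW.
  - exact: (measurable_funS _ abD mfD).
apply: ge0_subset_integral => //=.
Qed.

Lemma integral_expN (R : realType) (c a : R) : 0 < c ->
  (\int[@lebesgue_measure R]_(x in `[a, +oo[) (expR (- (c * x)))%:E =
    (c^-1 * expR (- (c * a)))%:E)%E.
Proof.
move=> c0.
pose F x := - c^-1 * expR (- (c * x)).
have dF (x : R) : is_derive x 1 F (expR (- (c * x))).
  have dM : is_derive x 1 (fun y : R => - (c * y)) (- c).
    have := is_deriveN (is_deriveZ c (is_derive_id x (1 : R))).
    by rewrite /GRing.scale/= mulr1.
  have := is_deriveZ (- c^-1) (@is_derive1_comp R expR _ x _ _
    (is_derive_expR _) dM).
  by rewrite /GRing.scale/= mulrN mulrNN mulrC -mulrA mulfV ?gt_eqF// mulr1.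
have cF : continuous F.
  by move=> x; apply: derivable1_continuous; have [] := dF x.
rewrite (@ge0_continuous_FTC2y _ _ F a 0).
- by rewrite /F mulNr EFinN oppeK add0e.
- by move=> x _; exact: expR_ge0.
- apply: continuous_subspaceT => x; apply: continuous_comp.
    by apply: cvgN; apply: cvgMl_tmp; exact: cvg_id.
  exact: continuous_expR.
- rewrite -(mulr0 (- c^-1)); apply: cvgMl_tmp.
  apply: (@cvg_comp _ _ _ (fun x => c * x) (fun x => expR (- x)) _ +oo).
    exact: (gt0_cvgMry c0).
  exact: cvgr_expR.
- by move=> x _; have [] := dF x.
- exact/cvg_at_right_filter/cF.
- by move=> x _; rewrite derive1E derive_val.
Qed.

(** A nonnegative function of infinite integral has [Rintegral] equal to [0], so
positivity includes convergence: the integrand is at most the power on ]0, 1] and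
at most the exponential on ]1, +oo[. *)
Lemma Gamma_gt0 (R : realType) (z : R) : 0 < z < 1 -> 0 < Gamma z.
Proof.
move=> /andP[z0 z1].
pose f s := s `^ (z - 1) * expR (- s).
have mf (D : set (measurableTypeR R)) : measurable_fun D (EFin \o f).
  apply/measurable_EFinP; apply: measurable_funM.
    exact: measurable_funTS.
  by apply: measurable_funTS; apply: measurableT_comp.
have f0 x : 0 <= f x by rewrite mulr_ge0 ?powR_ge0 ?expR_ge0.
have split_itv : `]0%R, +oo[%classic = `]0%R, 1%R] `|` `]1%R, +oo[ :> set R.
  by rewrite -itv_bndbnd_setU ?bnd_simp.
(* On [1, 2] the power is at least 1 / x, hence at least 1 / 2. *)
apply: (@Rintegral_gt0 _ _ _ 1 2 (2^-1 * expR (-2))) => //.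
- apply/integrableP; split; first exact: (mf _).
  rewrite (@eq_integral _ (measurableTypeR R) R _ _ (EFin \o f)); last first.
    by move=> x _; rewrite gee0_abs// lee_fin; exact: f0.
  rewrite split_itv ge0_integral_setU//=; last 2 first.
    by move=> x _; rewrite lee_fin; exact: f0.
    apply/disj_setPS => x; rewrite /= !in_itv/= => -[/andP[_ ?] /andP[? _]].
    lra.
  apply: lte_add_pinfty.
    apply: (@le_lt_trans _ _
        (\int[@lebesgue_measure R]_(x in `]0%R, 1%R]) (x `^ (z - 1))%:E)%E).
      apply: ge0_le_integral => //=.
      + by move=> x _; rewrite lee_fin; exact: f0.
      + exact/measurable_EFinP/measurable_funTS.
      + move=> x; rewrite in_itv/= => /andP[x0 x1].
        rewrite lee_fin ler_piMr ?powR_ge0// expR_le1. lra.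
    rewrite integral_itv_obnd_cbnd; last exact/measurable_EFinP/measurable_funTS.
    have := @integral_powR_right R (z - 1) 0 0 1.
    under eq_integral do rewrite subr0.
    by move=> ->//; [rewrite ltry|lra].
  apply: (@le_lt_trans _ _
      (\int[@lebesgue_measure R]_(x in `]1%R, +oo[) (expR (- (1 * x)))%:E)%E).
    apply: ge0_le_integral => //=.
    + by move=> x _; rewrite lee_fin; exact: f0.
    + apply/measurable_EFinP/measurable_funTS; apply: measurableT_comp => //.
      by apply: measurableT_comp => //; exact: measurable_funM.
    + move=> x; rewrite in_itv/= => /andP[x1 _].
      rewrite lee_fin mul1r ler_piMl ?expR_ge0//.
      rewrite -[leRHS](powRr0 x); apply: ler_powR; first exact: ltW.
      by lra.
  rewrite integral_itv_obnd_cbnd ?integral_expN ?ltry//.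
  apply/measurable_EFinP/measurable_funTS; apply: measurableT_comp => //.
  by apply: measurableT_comp => //; exact: measurable_funM.
- by move=> x _; exact: f0.
- by lra.
- by move=> x; rewrite /= !in_itv/= => /andP[? ?]; lra.
- move=> x /andP[x1 x2]; apply: ler_pM; rewrite ?expR_ge0//.
    apply: (@le_trans _ _ (x `^ (-1))).
      by rewrite powR_inv1 ?lef_pV2 ?posrE; lra.
    by apply: ler_powR => //; lra.
  by rewrite ler_expR lerN2.
Qed.

(** * Closed form of the L1+ coefficients *)

Lemma ge0_fin_integrable (R : realType) (D : set R) (f : R -> R) (r : R) :
  measurable_fun D f -> (forall x, D x -> 0 <= f x) ->
  (\int[@lebesgue_measure R]_(x in D) (f x)%:E = r%:E)%E ->
  (@lebesgue_measure R).-integrable D (EFin \o f).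
Proof.
move=> mf f0 fr; apply/integrableP; split; first exact/measurable_EFinP.
rewrite (@eq_integral _ (measurableTypeR R) R _ _ (EFin \o f)).
  by rewrite fr ltry.
by move=> x; rewrite inE => Dx; rewrite /= ger0_norm// f0.
Qed.

(** The case [w = r] is included: it is the weakly singular one, met on the last
time step. *)
Lemma integral_omega (R : realType) (al u w r : R) :
  0 < al < 1 -> u <= w -> w <= r ->
  \int[@lebesgue_measure R]_(s in `[u, w]) omega (1 - al) (r - s) =
  (Gamma (1 - al) * (1 - al))^-1 * ((r - u) `^ (1 - al) - (r - w) `^ (1 - al)).
Proof.
move=> /andP[al0 al1]; rewrite le_eqVlt => /predU1P[<- ur|uw wr].
  by rewrite set_itv1 Rintegral_set1 subrr mulr0.
have al1' : -1 < - al by lra.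
have int := @integral_powR_left R (- al) r u w al1' uw wr.
have -> : \int[@lebesgue_measure R]_(s in `[u, w]) omega (1 - al) (r - s) =
    \int[@lebesgue_measure R]_(s in `[u, w]) ((r - s) `^ (- al) / Gamma (1 - al)).
  apply: eq_Rintegral => s _; rewrite /omega; congr (_ `^ _ / _); ring.
rewrite RintegralZr//; last first.
  apply: (@ge0_fin_integrable _ _ _ _ _ _ int).
    apply: (measurableT_comp (measurable_powR _)).
    by apply: measurable_funB => //.
  by move=> x _; exact: powR_ge0.
rewrite /Rintegral int/= (addrC (- al)) invfM; ring.
Qed.

Lemma integral_powR_shift (R : realType) (p c a b : R) :
  -1 < p -> c <= a -> a < b ->
  (@lebesgue_measure R).-integrable `[a, b] (fun x => ((x - c) `^ p)%:E) /\
  \int[@lebesgue_measure R]_(x in `[a, b]) ((x - c) `^ p) =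
    ((b - c) `^ (p + 1) - (a - c) `^ (p + 1)) / (p + 1).
Proof.
move=> p1 ca ab; have int := @integral_powR_right R p c a b p1 ca ab.
split; last by rewrite /Rintegral int.
apply: (@ge0_fin_integrable _ _ _ _ _ _ int).
  apply: (measurableT_comp (measurable_powR _)).
  by apply: measurable_funB => //.
by move=> x _; exact: powR_ge0.
Qed.

Section L1plus_coef.
Variables (R : realType) (al : R).
Hypothesis al01 : 0 < al < 1.

(** This is [1 / Gamma (3 - al)], in the form that two successive integrations
of the kernel produce. *)
Definition L1plus_const : R := (Gamma (1 - al) * (1 - al) * (2 - al))^-1.

Lemma L1plus_const_gt0 : 0 < L1plus_const.
Proof.
case/andP: al01 => al0 al1.
rewrite invr_gt0 !mulr_gt0//; [apply: Gamma_gt0|..]; lra.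
Qed.

(** Two disjoint time steps: the double integral is a mixed second difference of
the second antiderivative of the kernel, a multiple of [x `^ (2 - al)]. *)
Lemma double_integral_omega_off (c e s0 s1 : R) :
  c < e -> e <= s0 -> s0 < s1 ->
  \int[@lebesgue_measure R]_(r in `[s0, s1])
    (\int[@lebesgue_measure R]_(s in `[c, Num.min r e]) omega (1 - al) (r - s)) =
  L1plus_const * ((s1 - c) `^ (2 - al) - (s1 - e) `^ (2 - al)
    - (s0 - c) `^ (2 - al) + (s0 - e) `^ (2 - al)).
Proof.
move=> ce es0 s01; case/andP: (al01) => al0 al1.
pose k := (Gamma (1 - al) * (1 - al))^-1.
transitivity (\int[@lebesgue_measure R]_(r in `[s0, s1])
    (k * ((r - c) `^ (1 - al) - (r - e) `^ (1 - al)))).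
  apply: eq_Rintegral => r; rewrite inE/= in_itv/= => /andP[s0r rs1].
  have er := le_trans es0 s0r.
  by rewrite (min_idPr er) integral_omega// ltW.
have p1 : -1 < 1 - al by lra.
have cs0 : c <= s0 by lra.
have [i1 v1] := @integral_powR_shift R (1 - al) c s0 s1 p1 cs0 s01.
have [i2 v2] := @integral_powR_shift R (1 - al) e s0 s1 p1 es0 s01.
rewrite RintegralZl//; last first.
  by apply: (integrableB _ i1 i2).
rewrite RintegralB// v1 v2 (_ : 1 - al + 1 = 2 - al); last by ring.
by rewrite /k /L1plus_const [in RHS]invfM; ring.
Qed.

(** One time step against itself, restricted to the past: half of the mixed
second difference of [`|x| `^ (2 - al)]. *)
Lemma double_integral_omega_diag (c s1 : R) :
  c < s1 ->
  \int[@lebesgue_measure R]_(r in `[c, s1])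
    (\int[@lebesgue_measure R]_(s in `[c, Num.min r s1]) omega (1 - al) (r - s)) =
  L1plus_const * (s1 - c) `^ (2 - al).
Proof.
move=> cs1; case/andP: (al01) => al0 al1.
pose k := (Gamma (1 - al) * (1 - al))^-1.
transitivity (\int[@lebesgue_measure R]_(r in `[c, s1])
    (k * (r - c) `^ (1 - al))).
  apply: eq_Rintegral => r; rewrite inE/= in_itv/= => /andP[cr rs1].
  rewrite (min_idPl rs1) integral_omega// subrr powR0 ?subr0//.
  by apply/eqP; lra.
have p1 : -1 < 1 - al by lra.
have [i1 v1] := @integral_powR_shift R (1 - al) c c s1 p1 (lexx c) cs1.
rewrite RintegralZl// v1 (_ : 1 - al + 1 = 2 - al); last by ring.
rewrite subrr powR0 ?subr0; last by apply/eqP; lra.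
by rewrite /k /L1plus_const [in RHS]invfM; ring.
Qed.

End L1plus_coef.

(** * Powers as superpositions of cosines *)

Lemma one_sub_cos_le (R : realType) (z : R) : 1 - cos z <= z ^+ 2 / 2.
Proof.
have sin_le (w : R) : 0 <= w -> `|sin w| <= w.
  move=> w0; have [|c _] := @MVT_segment R sin cos 0 w w0.
    by apply: continuous_subspaceT => x; exact: continuous_sin.
  rewrite sin0 !subr0 => ->; rewrite normrM (ger0_norm w0).
  by rewrite ler_piMl// cos_max.
have -> : 1 - cos z = 2 * sin (`|z| / 2) ^+ 2.
  rewrite -cos_norm {1}(splitr `|z|) cosD.
  have := cos2Dsin2 (`|z| / 2); lra.
have w0 : 0 <= `|z| / 2 by rewrite divr_ge0.
have := sin_le _ w0; rewrite -(ler_sqr (x := `|_|)) ?nnegrE//.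
rewrite !real_normK ?num_real// exprMn real_normK ?num_real//. lra.
Qed.

Lemma integrable_expN_norm (R : realType) (c : R) : 0 < c ->
  (@lebesgue_measure R).-integrable setT (fun y => (expR (- (c * `|y|)))%:E).
Proof.
move=> c0.
have cE : continuous (fun y : R => expR (- (c * `|y|))).
  move=> y; apply: continuous_comp; last exact: continuous_expR.
  by apply: cvgN; apply: cvgMl_tmp; exact: (@norm_continuous _ R^o).
apply: (@ge0_fin_integrable _ _ _ (2 * (c^-1 * expR (- (c * 0))))).
- exact: continuous_measurable_fun.
- by move=> x _; exact: expR_ge0.
rewrite ge0_symfun_integralT; last 3 first.
- by move=> x; exact: expR_ge0.
- exact: cE.
- by move=> x /=; rewrite normrN.
rewrite EFinM -(integral_expN 0 c0) -set_itvcy; congr (_ * _)%E.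
by apply: eq_integral => x; rewrite inE/= in_itv/= andbT => x0; rewrite ger0_norm.
Qed.

Section power_spectrum.
Variables (R : realType) (q : R).
Hypothesis q02 : 0 < q < 2.

(** Up to a constant, [`|x| `^ q] is the integral over [p > 0] of
[(1 - cos (p * x)) * p `^ (- 1 - q)].  The substitution [p = expR y] moves the
integral to the whole line: the singularity at [p = 0] disappears and scaling
[x] becomes translating [y]. *)
Definition spectrum (x y : R) : R := (1 - cos (expR y * x)) * expR (- (q * y)).

Lemma spectrum_ge0 x y : 0 <= spectrum x y.
Proof. by rewrite mulr_ge0 ?expR_ge0// subr_ge0 cos_le1. Qed.

Lemma continuous_spectrum x : continuous (spectrum x).
Proof.
move=> y; apply: cvgM; last first.
  apply: (@continuous_comp _ _ _ (fun y => - (q * y)) expR).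
    by apply: cvgN; apply: cvgMl_tmp; exact: cvg_id.
  exact: continuous_expR.
apply: cvgB; first exact: cvg_cst.
apply: (@continuous_comp _ _ _ (fun y => expR y * x) cos).
  by apply: cvgMr_tmp; exact: continuous_expR.
exact: continuous_cos.
Qed.

(** As [y] tends to [+oo] the bound is [2 * expR (- (q * y))]; as it tends to
[-oo], [1 - cos z <= z ^+ 2 / 2] gives a multiple of [expR ((2 - q) * y)]. *)
Lemma integrable_spectrum x :
  (@lebesgue_measure R).-integrable setT (EFin \o spectrum x).
Proof.
case/andP: (q02) => q0 q2.
pose c := Num.min q (2 - q); pose M := 2 + x ^+ 2.
have c0 : 0 < c by rewrite lt_min q0 subr_gt0.
have M0 : 0 <= M by rewrite addr_ge0// sqr_ge0.
have h := integrableZl measurableT M (integrable_expN_norm c0).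
apply: (le_integrable measurableT _ _ h).
  apply/measurable_EFinP; apply: continuous_measurable_fun.
  exact: continuous_spectrum.
move=> y _; rewrite /= lee_fin ger0_norm ?spectrum_ge0//.
rewrite ger0_norm ?mulr_ge0 ?expR_ge0// /spectrum.
have [y0|y0] := leP 0 y.
  apply: ler_pM; rewrite ?expR_ge0 ?subr_ge0 ?cos_le1//.
    have := cos_geN1 (expR y * x); have := sqr_ge0 x; rewrite /M; lra.
  by rewrite ler_expR lerN2 ger0_norm// ler_wpM2r// /c ge_min lexx.
apply: (@le_trans _ _ (x ^+ 2 * (expR (2 * y) * expR (- (q * y))))).
  rewrite mulrA ler_wpM2r ?expR_ge0//.
  apply: (le_trans (one_sub_cos_le _)).
  rewrite exprMn -expRM_natl. have := mulr_ge0 (sqr_ge0 x) (expR_ge0 (2 * y)).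
  lra.
rewrite -expRD; apply: ler_pM; rewrite ?sqr_ge0 ?expR_ge0//.
  by rewrite /M lerDr.
rewrite ler_expR ltr0_norm//.
have c2 : c <= 2 - q by rewrite /c ge_min lexx orbT.
have : 0 <= (2 - q - c) * - y by rewrite mulr_ge0 ?subr_ge0 ?oppr_ge0// ltW.
lra.
Qed.

Definition spectral_mass : R := \int[@lebesgue_measure R]_y spectrum 1 y.

Lemma spectral_mass_gt0 : 0 < spectral_mass.
Proof.
case/andP: (q02) => q0 q2.
have pi0 := pi_gt0 R; have hpi0 : 0 < pi / 2 :> R by rewrite divr_gt0.
(* For y between ln (pi / 2) and ln pi, expR y lies in the range from pi / 2 to
   pi, where the cosine is nonpositive. *)
apply: (@Rintegral_gt0 _ _ _ (ln (pi / 2)) (ln pi) (expR (- (q * ln pi)))) => //.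
- exact: integrable_spectrum.
- by move=> x _; exact: spectrum_ge0.
- by rewrite ltr_ln ?posrE//; lra.
- exact: expR_gt0.
- move=> y /andP[y1 y2]; rewrite -[leLHS]mul1r /spectrum mulr1.
  have e1 : pi / 2 <= expR y by rewrite -[pi / 2]lnK ?posrE// ler_expR.
  have e2 : expR y <= pi by rewrite -[leRHS]lnK ?posrE// ler_expR.
  apply: ler_pM; rewrite ?expR_ge0//.
    rewrite lerBrDr gerDl -(@cos_pihalf R) leNgt ltr_cos ?in_itv/=.
    + by rewrite -leNgt.
    + by apply/andP; split; lra.
    + by apply/andP; split; lra.
  by rewrite ler_expR lerN2 ler_pM2l.
Qed.

Lemma integral_spectrum (x : R) :
  \int[@lebesgue_measure R]_y spectrum `|x| y = `|x| `^ q * spectral_mass.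
Proof.
case/andP: (q02) => q0 q2.
have [->|x0] := eqVneq x 0.
  rewrite normr0 powR0 ?gt_eqF// mul0r.
  rewrite (_ : spectrum 0 = cst 0); first by rewrite Rintegral_cst// mul0r.
  by apply/funext => y; rewrite /spectrum mulr0 cos0 subrr mul0r.
have nx : 0 < `|x| by rewrite normr_gt0.
pose F (y : R) := y + ln `|x|.
have dF (y : R) : is_derive y 1 F 1 by exact: is_derive_shift.
have dF1 : F^`()%classic = cst 1.
  by apply/funext => y; rewrite derive1E derive_val.
have hF y : spectrum 1 (F y) = `|x| `^ (- q) * spectrum `|x| y.
  rewrite /spectrum /F expRD lnK ?posrE// mulr1 mulrDr opprD expRD.
  have -> : expR (- (q * ln `|x|)) = `|x| `^ (- q).
    by rewrite /powR gt_eqF// mulNr.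
  ring.
have mass : (\int[@lebesgue_measure R]_y (spectrum 1 y)%:E)%E =
    (\int[@lebesgue_measure R]_y (`|x| `^ (- q) * spectrum `|x| y)%:E)%E.
  rewrite (@increasing_ge0_integration_by_substitutionT R F).
  - by apply: eq_integral => y _; rewrite -hF dF1; congr EFin; exact: mulr1.
  - by move=> a b ab; rewrite /F ltrD2r.
  - by rewrite dF1; exact: cst_continuous.
  - by rewrite dF1; exact: is_cvg_cst.
  - by rewrite dF1; exact: is_cvg_cst.
  - by move=> y; have [] := dF y.
  - exact: cvg_addrr_Ny.
  - exact: cvg_addrr.
  - exact: continuous_spectrum.
  - exact: spectrum_ge0.
rewrite /spectral_mass [X in _ = _ * X]/Rintegral mass -/(Rintegral _ _ _).
rewrite RintegralZl//; last exact: integrable_spectrum.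
rewrite mulrA -powRD; last by rewrite (gt_eqF nx) implybT.
by rewrite subrr powRr0 mul1r.
Qed.

End power_spectrum.

(** * Positivity of the L1+ quadratic form *)

Section has_integral.
Variable R : realType.
Implicit Types (f g : R -> R) (r s : R).

(** Integrability and value travel together, so that identities between finite
combinations of integrals follow from pointwise identities. *)
Definition has_integral f r : Prop :=
  (@lebesgue_measure R).-integrable setT (EFin \o f) /\
  \int[@lebesgue_measure R]_y f y = r.

Lemma has_integral_ext f g r :
  f =1 g -> has_integral f r -> has_integral g r.
Proof. by move=> /funext ->. Qed.

Lemma has_integralD f g r s : has_integral f r -> has_integral g s ->
  has_integral (fun y => f y + g y) (r + s).
Proof.
move=> [intf fr] [intg gs]; split; last by rewrite RintegralD// fr gs.
by apply: (integrableD _ intf intg).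
Qed.

Lemma has_integralZ f r s : has_integral f r ->
  has_integral (fun y => s * f y) (s * r).
Proof.
move=> [intf fr]; split; last by rewrite RintegralZl// fr.
by apply: (integrableZl _ _ intf).
Qed.

Lemma has_integralB f g r s : has_integral f r -> has_integral g s ->
  has_integral (fun y => f y - g y) (r - s).
Proof.
move=> intf /(has_integralZ (-1)) intg; rewrite -mulN1r.
by apply: has_integral_ext (has_integralD intf intg) => y; rewrite mulN1r.
Qed.

Lemma has_integral_sum m n (f : nat -> R -> R) (r : nat -> R) :
  (forall i, has_integral (f i) (r i)) ->
  has_integral (fun y => \sum_(m <= i < n) f i y) (\sum_(m <= i < n) r i).
Proof.
move=> fr; elim: n => [|n IHn].
  rewrite big_geq//; split.
    apply: (eq_integrable _ (cst 0%E)) => //; last exact: integrable0.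
    by move=> y _; rewrite /= big_geq.
  rewrite (_ : (fun y => _) = cst 0); first by rewrite Rintegral_cst// mul0r.
  by apply/funext => y; rewrite big_geq.
have [mn|nm] := leqP m n.
  rewrite big_nat_recr//=.
  apply: has_integral_ext (has_integralD IHn (fr n)) => y.
  by rewrite big_nat_recr.
rewrite big_geq//; move: IHn; rewrite big_geq; last exact: ltnW.
by apply: has_integral_ext => y; rewrite !big_geq// ltnW.
Qed.

Lemma has_integral_ge0 f r : has_integral f r -> (forall y, 0 <= f y) -> 0 <= r.
Proof. by move=> [_ <-] f0; apply: Rintegral_ge0. Qed.

End has_integral.

Section power_kernel.
Variables (R : realType) (q : R) (t : nat -> R).
Hypothesis q02 : 0 < q < 2.

(** Mixed second difference of [`|x - y| `^ q] over the time steps [m] and [k].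
*)
Definition power_cross (m k : nat) : R :=
  `|t m - t k.-1| `^ q - `|t m - t k| `^ q
  - `|t m.-1 - t k.-1| `^ q + `|t m.-1 - t k| `^ q.

(** For symmetric [K], one half of its full quadratic form. *)
Definition half_form (K : nat -> nat -> R) (u : nat -> R) (n : nat) : R :=
  \sum_(1 <= m < n.+1)
    (\sum_(1 <= k < m) u m * u k * K m k + 2^-1 * (u m * u m * K m m)).

Lemma half_form_rank1 (p u : nat -> R) n :
  half_form (fun m k => p m * p k) u n =
  2^-1 * (\sum_(1 <= m < n.+1) u m * p m) ^+ 2.
Proof.
rewrite /half_form; elim: n => [|n IHn].
  by rewrite !big_geq// expr0n mulr0.
rewrite big_nat_recr//= IHn [in RHS]big_nat_recr//=.
have -> : \sum_(1 <= k < n.+1) u n.+1 * u k * (p n.+1 * p k) =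
    u n.+1 * p n.+1 * \sum_(1 <= k < n.+1) u k * p k.
  by rewrite big_distrr/=; apply: eq_bigr => k _; ring.
by field.
Qed.

Lemma half_formD (K L : nat -> nat -> R) u n :
  half_form (fun m k => K m k + L m k) u n = half_form K u n + half_form L u n.
Proof.
rewrite /half_form -big_split/=; apply: eq_bigr => m _.
under eq_bigr do rewrite mulrDr.
by rewrite big_split/=; ring.
Qed.

Lemma half_formZ (c : R) (K : nat -> nat -> R) u n :
  half_form (fun m k => c * K m k) u n = c * half_form K u n.
Proof.
rewrite /half_form big_distrr/=; apply: eq_bigr => m _.
rewrite mulrDr big_distrr/=; congr (_ + _); last by ring.
by apply: eq_bigr => k _; ring.
Qed.

Lemma has_integral_half_form (K : nat -> nat -> R -> R) (L : nat -> nat -> R) u n :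
  (forall m k, has_integral (K m k) (L m k)) ->
  has_integral (fun y => half_form (fun m k => K m k y) u n) (half_form L u n).
Proof.
move=> KL; apply: has_integral_sum => m; apply: has_integralD.
  by apply: has_integral_sum => k; exact: has_integralZ.
by do 2 apply: has_integralZ.
Qed.

(** Conditional negative definiteness of [`|x - y| `^ q].  In the spectral
representation the constant terms cancel in the mixed difference and
[cos (x - y) = cos x * cos y + sin x * sin y] leaves two kernels of the form
[p m * p k], whose half forms are squares. *)
Lemma power_form_ge0 (u : nat -> R) n : 0 <= half_form power_cross u n.
Proof.
pose c y i := cos (expR y * t i); pose s y i := sin (expR y * t i).
pose K m k y := expR (- (q * y)) *
  ((c y m - c y m.-1) * (c y k - c y k.-1)
   + (s y m - s y m.-1) * (s y k - s y k.-1)).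
have hspec i j : has_integral (spectrum q `|t i - t j|)
    (`|t i - t j| `^ q * spectral_mass q).
  split; last exact: integral_spectrum.
  exact: integrable_spectrum.
have hK m k : has_integral (K m k) (spectral_mass q * power_cross m k).
  have h := has_integralD (has_integralB
    (has_integralB (hspec m k.-1) (hspec m k)) (hspec m.-1 k.-1))
    (hspec m.-1 k).
  rewrite (_ : _ * _ = `|t m - t k.-1| `^ q * spectral_mass q -
     `|t m - t k| `^ q * spectral_mass q
     - `|t m.-1 - t k.-1| `^ q * spectral_mass q
     + `|t m.-1 - t k| `^ q * spectral_mass q); last by rewrite /power_cross; ring.
  apply: has_integral_ext h => y; rewrite /K /spectrum.
  have cosE i j : cos (expR y * `|t i - t j|) = c y i * c y j + s y i * s y j.
    rewrite -[X in X * `|_|]gtr0_norm ?expR_gt0// -normrM cos_norm mulrBr.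
    exact: cosB.
  rewrite !cosE; ring.
rewrite -(pmulr_rge0 _ (spectral_mass_gt0 q02)) -half_formZ.
apply: has_integral_ge0 (has_integral_half_form u n hK) _ => y.
rewrite half_formZ half_formD !half_form_rank1.
by rewrite mulr_ge0 ?expR_ge0// addr_ge0// mulr_ge0// sqr_ge0.
Qed.

End power_kernel.

Section L1plus_positivity.
Variables (R : realType) (al T : R) (N : nat) (t : nat -> R).
Hypotheses (al01 : 0 < al < 1) (mesh : time_mesh N T t).

Lemma time_mesh_lt i j : (i < j)%N -> (j <= N)%N -> t i < t j.
Proof.
case: mesh => _ _ step; elim: j => // j IHj.
rewrite ltnS leq_eqVlt => /predU1P[-> jN|ij jN]; first exact: step.
by rewrite (lt_trans (IHj ij (ltnW jN)))// step.
Qed.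

Lemma time_mesh_le i j : (i <= j)%N -> (j <= N)%N -> t i <= t j.
Proof.
by rewrite leq_eqVlt => /predU1P[->//|ij jN]; rewrite ltW// time_mesh_lt.
Qed.

Lemma tau_gt0 k : (0 < k <= N)%N -> 0 < tau t k.
Proof.
by move=> /andP[k0 kN]; rewrite subr_gt0 time_mesh_lt// prednK.
Qed.

Lemma L1plus_coef_off n k : (0 < k < n)%N -> (n <= N)%N ->
  L1plus_coef al t n k =
  L1plus_const al * ((tau t n)^-1 * (tau t k)^-1 * power_cross (2 - al) t n k).
Proof.
move=> /andP[k0 kn] nN; have n0 : (0 < n)%N by exact: ltn_trans kn.
have lek : t k.-1 < t k by rewrite time_mesh_lt ?prednK// (leq_trans (ltnW kn)).
have kn1 : t k <= t n.-1.
  by rewrite time_mesh_le ?(leq_trans (leq_pred _))// -ltnS prednK.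
have len : t n.-1 < t n by rewrite time_mesh_lt ?prednK.
rewrite /L1plus_coef double_integral_omega_off// /power_cross.
rewrite invfM !ger0_norm ?subr_ge0; [ring|lra..].
Qed.

Lemma L1plus_coef_diag n : (0 < n <= N)%N ->
  L1plus_coef al t n n =
  L1plus_const al * ((tau t n)^-1 * (tau t n)^-1 * tau t n `^ (2 - al)).
Proof.
move=> nN; have := tau_gt0 nN; rewrite /tau subr_gt0 => tn.
by rewrite /L1plus_coef double_integral_omega_diag// /tau invfM; ring.
Qed.

Lemma L1plus_coef_diag_gt0 n : (0 < n <= N)%N -> 0 < L1plus_coef al t n n.
Proof.
move=> nN; rewrite L1plus_coef_diag// mulr_gt0 ?L1plus_const_gt0//.
by rewrite !mulr_gt0 ?powR_gt0 ?invr_gt0 ?tau_gt0.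
Qed.

(** The discrete fractional derivative tested against the increments is, after
division of each increment by its time step, a half form of [power_cross]; the
diagonal coefficient carries the factor one half because [power_cross t m m]
counts the step length twice. *)
Lemma L1plus_form_ge0 (w : nat -> R) n : (n <= N)%N ->
  0 <= \sum_(1 <= m < n.+1) nabla w m * L1plus al t w m.
Proof.
move=> nN; case/andP: (al01) => al0 al1.
have q02 : 0 < 2 - al < 2 by apply/andP; split; lra.
have := power_form_ge0 t q02 (fun k => nabla w k / tau t k) n.
rewrite -(pmulr_rge0 _ (L1plus_const_gt0 al01)).
rewrite (_ : _ * _ = \sum_(1 <= m < n.+1) nabla w m * L1plus al t w m)//.
rewrite /half_form big_distrr/= !big_nat; apply: eq_bigr => m /andP[m0 mn].
have mN : (m <= N)%N by rewrite (leq_trans _ nN).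
rewrite /L1plus big_nat_recr//= mulrDr [in RHS]mulrDr !big_distrr/=.
congr (_ + _).
  rewrite !big_nat; apply: eq_bigr => k km.
  by rewrite L1plus_coef_off//; ring.
have tm : 0 < tau t m by rewrite tau_gt0// m0.
rewrite L1plus_coef_diag ?m0// /power_cross.
rewrite (_ : `|t m.-1 - t m| = `|t m - t m.-1|); last by rewrite distrC.
rewrite -/(tau t m) gtr0_norm// !subrr normr0 powR0; last by apply/eqP; lra.
by field; rewrite gt_eqF.
Qed.

End L1plus_positivity.

(** * Continuous functions on a box *)

Section row_vectors.
Variables (R : realType) (d : nat).

Lemma cvg_row (S : Type) (F : set_system S) {FF : Filter F}
    (h : S -> 'rV[R]_d) (l : 'rV[R]_d) :
  (forall i, h s 0 i @[s --> F] --> l 0 i) -> h s @[s --> F] --> l.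
Proof.
move=> hl; apply/cvg_ballP => e e0.
have /filter_forall : forall i, \forall s \near F, ball (l 0 i) e (h s 0 i).
  by move=> i; move/cvg_ballP : (hl i) => /(_ e e0).
by apply: filterS => s hs; split => // i j; rewrite (ord1 i).
Qed.

(** Tuples carry the product sigma-algebra and rows the normed topology.  A
continuous function is the pointwise limit of its values at the nodes of the
grids of mesh [1 / n.+1], which are constant on each of countably many measurable
cells. *)
Lemma measurable_continuous_row_of_tuple (f : 'rV[R]_d -> R) : continuous f ->
  measurable_fun setT (fun p : d.-tuple (measurableTypeR R) => f (row_of_tuple p)).
Proof.
move=> cf.
pose z n (p : d.-tuple (measurableTypeR R)) : 'rV[int]_d :=
  \row_i Num.floor (tnth p i * n.+1%:R).
pose g n (k : 'rV[int]_d) : 'rV[R]_d := \row_i ((k 0 i)%:~R / n.+1%:R).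
apply: (@measurable_fun_cvg _ _ _ _ (fun n p => f (g n (z n p)))); last first.
  move=> p _; apply: (continuous_cvg _ (cf _)); apply: cvg_row => i.
  rewrite !mxE; apply/cvgrPdist_le => e e0.
  have /cvgrPdist_le/(_ _ e0) := @cvg_harmonic R.
  apply: filterS => n; rewrite /= sub0r normrN ger0_norm ?invr_ge0// => ne.
  rewrite !mxE; apply: le_trans ne; set x : R := tnth p i.
  have n0 : 0 < n.+1%:R :> R by rewrite ltr0n.
  have -> : x - (Num.floor (x * n.+1%:R))%:~R / n.+1%:R =
      (x * n.+1%:R - (Num.floor (x * n.+1%:R))%:~R) / n.+1%:R.
    by rewrite mulrBl mulfK ?gt_eqF.
  have := floor_itv (x * n.+1%:R); rewrite intrD1 => /andP[f1 f2].
  rewrite ger0_norm; last by rewrite divr_ge0 ?subr_ge0.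
  by rewrite ler_pdivrMr// mulVf ?gt_eqF// lerBlDl ltW.
move=> n _ B mB; rewrite setTI.
rewrite (_ : _ @^-1` _ = \bigcup_(k in [set k | B (f (g n k))])
    (z n @^-1` [set k])); last first.
  apply/seteqP; split => [p Bp|p [k Bk /= zk]]; first by exists (z n p).
  by rewrite /= zk.
rewrite bigcup_mkcond; apply: countable_bigcupT_measurable => // k.
case: ifPn => // _.
rewrite (_ : _ @^-1` _ = \bigcap_(i in [set: 'I_d])
   ((fun p => @tnth d (measurableTypeR R) p i) @^-1`
     [set x | Num.floor (x * n.+1%:R) = k 0 i])); last first.
  apply/seteqP; split => [p /= <- i _|p kp] /=; first by rewrite mxE.
  by apply/rowP => i; rewrite mxE; exact: kp.
apply: fin_bigcap_measurable => // i _.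
rewrite -[X in measurable X]setTI; apply: measurable_tnth => //.
rewrite (_ : mkset _ = `[(k 0 i)%:~R / n.+1%:R, (k 0 i + 1)%:~R / n.+1%:R[%classic).
  exact: measurable_itv.
have n0 : 0 < n.+1%:R :> R by rewrite ltr0n.
apply/seteqP; split => x /=; rewrite in_itv/= ler_pdivrMr// ltr_pdivlMr//.
  by move=> <-; exact: floor_itv.
by move=> h; exact: floor_def.
Qed.
End row_vectors.

Section boxes.
Variable R : realType.
Local Notation leb := (@lebesgue_measure R).
Local Notation RT := (measurableTypeR R).

Definition box d (a b : 'rV[R]_d) : set (d.-tuple RT) :=
  @row_of_tuple R d @^-1` rect a b.

Lemma measurable_box d (a b : 'rV[R]_d) : measurable (box a b).
Proof.
rewrite (_ : box a b = \bigcap_(i in [set: 'I_d])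
   ((fun p => @tnth d RT p i) @^-1` `]a 0 i, b 0 i[%classic)).
  apply: fin_bigcap_measurable => // i _; rewrite -[X in measurable X]setTI.
  by apply: measurable_tnth => //; exact: measurable_itv.
apply/seteqP; split => [p bp i _|p bp i]; first by have := bp i; rewrite mxE/= in_itv.
by have := bp i I; rewrite mxE/= in_itv.
Qed.

Lemma bounded_on_box d (a b : 'rV[R]_d) (f : 'rV[R]_d -> R) : continuous f ->
  exists M : R, forall p, box a b p -> `|f (row_of_tuple p)| <= M.
Proof.
move=> cf.
have cK := @rV_compact R d (fun i => `[a 0 i, b 0 i]%classic)
  (fun i => @segment_compact _ (a 0 i) (b 0 i)).
have /compact_bounded[M [_ HM]] :=
  @continuous_compact _ _ f _ (continuous_subspaceT cf) cK.
exists (M + 1) => p bp; apply: HM; first by rewrite ltrDl.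
exists (row_of_tuple p) => // i; have := bp i.
by rewrite /= in_itv/= => /andP[? ?]; rewrite !ltW.
Qed.

(** The counterpart on rows of [tuple_cons], through which the Lebesgue measure
is defined by recursion on the dimension. *)
Definition row_cons d (s : R) (y : 'rV[R]_d) : 'rV[R]_d.+1 :=
  \row_i (if unlift ord0 i is Some j then y 0 j else s).

Lemma row_cons0 d s (y : 'rV[R]_d) : row_cons s y 0 ord0 = s.
Proof. by rewrite mxE unlift_none. Qed.

Lemma row_consS d s (y : 'rV[R]_d) j : row_cons s y 0 (lift ord0 j) = y 0 j.
Proof. by rewrite mxE liftK. Qed.

Lemma row_of_tuple_cons d (z : RT * d.-tuple RT) :
  row_of_tuple (tuple_cons z) = row_cons z.1 (row_of_tuple z.2).
Proof.
apply/rowP => i; have [j ->|->] := unliftP ord0 i.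
  by rewrite row_consS !mxE tnthS.
by rewrite row_cons0 mxE tnth0.
Qed.

Lemma rect_row_cons d (a b : 'rV[R]_d.+1) s (y : 'rV[R]_d) :
  rect a b (row_cons s y) <->
  a 0 0 < s < b 0 0 /\ rect (col' ord0 a) (col' ord0 b) y.
Proof.
split=> [h|[h0 hy] i].
  split=> [|j]; first by have := h ord0; rewrite row_cons0.
  by have := h (lift ord0 j); rewrite row_consS !mxE.
have [j ->|->] := unliftP ord0 i; last by rewrite row_cons0.
by have := hy j; rewrite row_consS !mxE.
Qed.

Lemma preimage_tuple_cons_box d (a b : 'rV[R]_d.+1) :
  @tuple_cons R d @^-1` box a b =
  `]a 0 0, b 0 0[%classic `*` box (col' ord0 a) (col' ord0 b).
Proof.
apply/seteqP; split => [[s p]|[s p]].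
  rewrite /box /= row_of_tuple_cons => /rect_row_cons[? ?].
  by split => //=; rewrite in_itv.
rewrite /box /= in_itv/= => -[? ?].
by rewrite row_of_tuple_cons; apply/rect_row_cons.
Qed.

Lemma lebesgue_box d (a b : 'rV[R]_d) : (forall i, a 0 i < b 0 i) ->
  lebesgue_tuple R d (box a b) = (\prod_(i < d) (b 0 i - a 0 i))%:E.
Proof.
elim: d a b => [|d IHd] a b ab.
  rewrite big_ord0 /= diracE mem_set//= => -[]//.
rewrite /= /lebesgue_cons /pushforward preimage_tuple_cons_box.
rewrite product_measure1E//; last exact: measurable_box.
rewrite big_ord_recl EFinM; congr (_ * _)%E.
  by rewrite -[LHS]/(leb _) lebesgue_measure_itv/= lte_fin ab -EFinD.
rewrite IHd; last by move=> i; rewrite !mxE.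
by congr EFin; apply: eq_bigr => i _; rewrite !mxE.
Qed.

Lemma integrable_box d (a b : 'rV[R]_d) (f : 'rV[R]_d -> R) :
  (forall i, a 0 i < b 0 i) -> continuous f ->
  (lebesgue_tuple R d).-integrable (box a b) (fun p => (f (row_of_tuple p))%:E).
Proof.
move=> ab cf; have [M HM] := bounded_on_box a b cf.
apply: (@measurable_bounded_integrable _ _ _ _ (fun p => f (row_of_tuple p))).
- exact: measurable_box.
- have : (lebesgue_tuple R d (box a b) < +oo)%E by rewrite lebesgue_box// ltry.
  exact.
- by apply: measurable_funTS; exact: measurable_continuous_row_of_tuple.
- exists M; split; first exact: num_real.
  by move=> N MN p /= bp; rewrite (le_trans (HM p bp))// ltW.
Qed.

End boxes.

(** * Iterated integrals over a box *)

Section fubini_box.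
Variable R : realType.
Local Notation leb := (@lebesgue_measure R).
Local Notation RT := (measurableTypeR R).

Lemma continuous_row_cons_tail d s : continuous (@row_cons R d s).
Proof.
move=> y; apply: (@cvg_row R _ _ (nbhs y)) => i; rewrite mxE.
have [j ->|->] := unliftP ord0 i.
  rewrite (_ : (fun y => _) = fun y : 'rV[R]_d => y 0 j); last first.
    by apply/funext => z; rewrite row_consS.
  exact: coord_continuous.
rewrite (_ : (fun y => _) = fun _ : 'rV[R]_d => s); first exact: cvg_cst.
by apply/funext => z; rewrite row_cons0.
Qed.

Lemma continuous_row_cons_head d (y : 'rV[R]_d) : continuous (fun s => row_cons s y).
Proof.
move=> s; apply: (@cvg_row R _ _ (nbhs s)) => i; rewrite mxE.
have [j ->|->] := unliftP ord0 i.
  rewrite (_ : (fun s => _) = fun _ : R => y 0 j); first exact: cvg_cst.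
  by apply/funext => z; rewrite row_consS.
rewrite (_ : (fun s => _) = id); first exact: cvg_id.
by apply/funext => z; rewrite row_cons0.
Qed.

Variables (d : nat) (a b : 'rV[R]_d.+1) (f : 'rV[R]_d.+1 -> R).
Hypotheses (ab : forall i, a 0 i < b 0 i) (cf : continuous f).
Local Notation I := `]a 0 0, b 0 0[%classic.
Local Notation B := (box (col' ord0 a) (col' ord0 b)).

Let G (z : RT * d.-tuple RT) : \bar R := (f (row_cons z.1 (row_of_tuple z.2)))%:E.

Let ab' i : (col' ord0 a) 0 i < (col' ord0 b) 0 i.
Proof. by rewrite !mxE. Qed.

Let mIB : measurable (I `*` B).
Proof. by apply: measurableX => //; exact: measurable_box. Qed.

Let GE : G = (fun p => (f (row_of_tuple p))%:E) \o @tuple_cons R d.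
Proof. by apply/funext => z; rewrite /G /= row_of_tuple_cons. Qed.

Let mf : measurable_fun setT
  (fun p : d.+1.-tuple RT => (f (row_of_tuple p))%:E).
Proof. by apply/measurable_EFinP; exact: measurable_continuous_row_of_tuple. Qed.

Let intG : (leb \x lebesgue_tuple R d)%E.-integrable (I `*` B) G.
Proof.
have [M HM] := bounded_on_box a b cf.
rewrite GE; apply: (@measurable_bounded_integrable _ _ _ _
  ((fun p => f (row_of_tuple p)) \o @tuple_cons R d)) => //.
- have : (lebesgue_tuple R d.+1 (box a b) < +oo)%E by rewrite lebesgue_box// ltry.
  by rewrite /= /lebesgue_cons /pushforward preimage_tuple_cons_box.
- apply: measurable_funTS; apply: measurableT_comp.
    exact: measurable_continuous_row_of_tuple.
  exact: measurable_tuple_cons.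
- exists M; split; first exact: num_real.
  move=> N MN z; rewrite -preimage_tuple_cons_box => /HM h.
  by rewrite /= (le_trans h)// ltW.
Qed.

Let rect_intE : rect_int a b f =
  fine (\int[(leb \x lebesgue_tuple R d)%E]_(z in I `*` B) G z).
Proof.
rewrite /rect_int /Rintegral; congr fine.
have -> : (\int[lebesgue_tuple R d.+1]_(p in box a b)
    (f (row_of_tuple p))%:E = \int[pushforward (leb \x lebesgue_tuple R d)%E
    (@tuple_cons R d)]_(p in box a b) (f (row_of_tuple p))%:E)%E by [].
rewrite integral_pushforward//.
- by rewrite preimage_tuple_cons_box GE.
- exact: measurable_tuple_cons.
- by rewrite preimage_tuple_cons_box -GE.
- exact: measurable_box.
Qed.

Let intGT : (leb \x lebesgue_tuple R d)%E.-integrable setT (G \_ (I `*` B)).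
Proof. by rewrite -integrable_mkcond. Qed.

(* Rintegral takes the finite part of the inner integral: it has to be finite
for the iterated integrals to agree. *)
Let inner_fin s : (\int[lebesgue_tuple R d]_(p in B) G (s, p))%E \is a fin_num.
Proof.
apply: integrable_fin_num; first exact: measurable_box.
apply: (integrable_box ab' (f := fun y => f (row_cons s y))) => y.
by apply: continuous_comp; [exact: continuous_row_cons_tail|exact: cf].
Qed.

Lemma rect_int_cons : rect_int a b f =
  \int[leb]_(s in I) rect_int (col' ord0 a) (col' ord0 b) (fun y => f (row_cons s y)).
Proof.
rewrite rect_intE [RHS]/Rintegral; congr fine.
rewrite [LHS]integral_mkcond -(integral12_prod_meas1 intGT).
rewrite [RHS]integral_mkcond; apply: eq_integral => s _.
rewrite patchE; case: ifPn => sI.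
  rewrite fineK; last exact: inner_fin.
  rewrite [RHS]integral_mkcond; apply: eq_integral => p _.
  rewrite !patchE; congr (if _ then _ else _).
  by rewrite in_setX/= sI.
apply: integral0_eq => p _; rewrite patchE in_setX/=.
by rewrite (negbTE sI).
Qed.

Lemma rect_int_cons_swap : rect_int a b f =
  rect_int (col' ord0 a) (col' ord0 b) (fun y => \int[leb]_(s in I) f (row_cons s y)).
Proof.
rewrite rect_intE /rect_int [RHS]/Rintegral; congr fine.
rewrite [LHS]integral_mkcond -(integral21_prod_meas1 intGT).
rewrite [RHS]integral_mkcond; apply: eq_integral => p _.
rewrite patchE; case: ifPn => pB.
  rewrite fineK.
    rewrite [RHS]integral_mkcond; apply: eq_integral => s _.
    rewrite !patchE; congr (if _ then _ else _).
    by rewrite in_setX/= pB andbT.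
  apply: integrable_fin_num; first exact: measurable_itv.
  apply: (@integrableS _ _ _ leb `[a 0 0, b 0 0]%classic) => //.
    exact: subset_itv_oo_cc.
  apply: continuous_compact_integrable; first exact: segment_compact.
  apply: continuous_subspaceT => s.
  by apply: continuous_comp; [exact: continuous_row_cons_head|exact: cf].
apply: integral0_eq => s _; rewrite patchE in_setX/=.
by rewrite (negbTE pB) andbF.
Qed.
End fubini_box.

(** * Integration by parts on a periodic box *)

(** A map that sends the line through [x] along [v] to the line through [phi x]
along [w] preserves difference quotients.  This transports directional
derivatives to coordinate slices and across a period. *)
Lemma derive_translate (R : realType) (V W U : normedModType R) (f : W -> U)
    (phi : V -> W) (x v : V) (w : W) :
  (forall h : R, phi (h *: v + x) = h *: w + phi x) ->
  (derivable f (phi x) w -> derivable (f \o phi) x v) /\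
  'D_v (f \o phi) x = 'D_w f (phi x).
Proof.
move=> hphi; rewrite /derivable /derive.
rewrite (_ : (fun h : R => h^-1 *: (((f \o phi) \o shift x) (h *: v) - (f \o phi) x)) =
   (fun h : R => h^-1 *: ((f \o shift (phi x)) (h *: w) - f (phi x))))//.
by apply/funext => h; rewrite /= hphi.
Qed.

Lemma row_cons_head_translate (R : realType) d (y : 'rV[R]_d) (s h : R) :
  row_cons (h *: 1 + s) y = h *: delta_mx 0 ord0 + row_cons s y.
Proof.
apply/rowP => i; have [j ->|->] := unliftP ord0 i.
  by rewrite row_consS !mxE liftK/= mulr0 add0r.
by rewrite row_cons0 !mxE unlift_none /= /GRing.scale/= mulr1.
Qed.

Lemma row_cons_tail_translate (R : realType) d (y : 'rV[R]_d) (s h : R) j :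
  row_cons s (h *: delta_mx 0 j + y) =
  h *: delta_mx 0 (lift ord0 j) + row_cons s y.
Proof.
apply/rowP => i; have [k ->|->] := unliftP ord0 i.
  by rewrite row_consS !mxE liftK/= (inj_eq (@lift_inj _ ord0)).
by rewrite row_cons0 !mxE unlift_none/= mulr0 add0r.
Qed.

(** Induction on the dimension, along the recursive definition of the measure.
In the first direction, integrate in that variable first: the fundamental
theorem of calculus leaves a difference of values one period apart.  In another
direction, freeze the first coordinate. *)
Lemma rect_int_partial_periodic (R : realType) d (a b : 'rV[R]_d)
    (g : 'rV[R]_d -> R) (i : 'I_d) :
  (forall j, a 0 j < b 0 j) -> continuous g ->
  (forall x, derivable g x (delta_mx 0 i)) -> continuous (partial i g) ->
  (forall x, g (x + (b 0 i - a 0 i) *: delta_mx 0 i) = g x) ->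
  rect_int a b (partial i g) = 0.
Proof.
elim: d a b g i => [|d IHd] a b g i; first by case: i.
move=> ab cg dg cdg per.
have [j ij|i0] := unliftP ord0 i; last first.
  rewrite rect_int_cons_swap// (_ : (fun y => _) = cst 0).
    by rewrite /rect_int Rintegral_cst ?mul0r//; exact: measurable_box.
  apply/funext => y /=.
  have tr (s : R) := @derive_translate R R^o _ R^o g (fun s => row_cons s y) s 1 _
    (row_cons_head_translate y s).
  pose F s := g (row_cons s y).
  have cF : continuous F.
    move=> s; apply: continuous_comp; last exact: cg.
    exact: continuous_row_cons_head.
  have cdF : continuous (fun s => partial i g (row_cons s y)).
    move=> s; apply: continuous_comp; last exact: cdg.
    exact: continuous_row_cons_head.
  have dF s : derivable F s 1 /\ 'D_1 F s = partial i g (row_cons s y).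
    by rewrite /partial i0; have [h1 h2] := tr s; split=> //; apply: h1; rewrite -i0.
  have perF : F (b 0 0) = F (a 0 0).
    rewrite /F -(per (row_cons (a 0 0) y)) i0 addrC -row_cons_head_translate.
    by rewrite /GRing.scale/= mulr1 subrK.
  rewrite /Rintegral -(@integral_itv_bndoo R _ _ _ true false).
    rewrite (@continuous_FTC2 R _ F)//.
    - by rewrite perF subee.
    - exact: continuous_subspaceT.
    - split; [|exact/cvg_at_right_filter/cF|exact/cvg_at_left_filter/cF].
      by move=> s _; have [] := dF s.
    - by move=> s _; rewrite derive1E; have [] := dF s.
  apply/measurable_EFinP/measurable_funTS.
  exact: continuous_measurable_fun.
rewrite rect_int_cons// (_ : (fun s => _) = cst 0).
  by rewrite Rintegral_cst ?mul0r//; exact: measurable_itv.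
apply/funext => s /=.
have tr (y : 'rV[R]_d) := @derive_translate R _ _ R^o g (row_cons s) y _ _
  (fun h => row_cons_tail_translate y s h j).
rewrite (_ : (fun y => _) = partial j (fun y => g (row_cons s y))); last first.
  by apply/funext => y; rewrite /partial ij; have [_ <-] := tr y.
apply: IHd.
- by move=> k; rewrite !mxE.
- move=> y; apply: continuous_comp; last exact: cg.
  exact: continuous_row_cons_tail.
- by move=> y; have [h1 _] := tr y; apply: h1; rewrite -ij.
- rewrite (_ : partial _ _ = partial i g \o row_cons s).
    move=> y; apply: continuous_comp; last exact: cdg.
    exact: continuous_row_cons_tail.
  by apply/funext => y; rewrite /partial ij; have [_ ->] := tr y.
- move=> y; rewrite !mxE addrC row_cons_tail_translate addrC -ij; exact: per.
Qed.

Section continuous_functions.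
Variables (R : realType) (d : nat).
Implicit Types f g : 'rV[R]_d -> R.

Lemma continuous_add f g : continuous f -> continuous g ->
  continuous (fun x => f x + g x).
Proof. by move=> cf cg x; exact: (cvgD (cf x) (cg x)). Qed.

Lemma continuous_mul f g : continuous f -> continuous g ->
  continuous (fun x => f x * g x).
Proof. by move=> cf cg x; exact: (cvgM (cf x) (cg x)). Qed.

Lemma continuous_scale (c : R) f : continuous f -> continuous (fun x => c * f x).
Proof. by move=> cf; apply: continuous_mul => //; exact: cst_continuous. Qed.

Lemma continuous_sum (I : eqType) (s : seq I) (f : I -> 'rV[R]_d -> R) :
  (forall i, i \in s -> continuous (f i)) ->
  continuous (fun x => \sum_(i <- s) f i x).
Proof.
elim: s => [_|i s IHs cf].
  by under eq_fun do rewrite big_nil; exact: cst_continuous.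
under eq_fun do rewrite big_cons; apply: continuous_add.
  by apply: cf; rewrite mem_head.
by apply: IHs => j js; apply: cf; rewrite inE js orbT.
Qed.

End continuous_functions.

Section rect_int_linear.
Variables (R : realType) (d : nat) (a b : 'rV[R]_d).
Hypothesis ab : forall i, a 0 i < b 0 i.
Implicit Types f g : 'rV[R]_d -> R.

Lemma eq_rect_int f g : (forall x, rect a b x -> f x = g x) ->
  rect_int a b f = rect_int a b g.
Proof.
by move=> fg; apply: eq_Rintegral => p; rewrite inE => /= bp; exact: fg.
Qed.

Lemma rect_intD f g : continuous f -> continuous g ->
  rect_int a b (fun x => f x + g x) = rect_int a b f + rect_int a b g.
Proof.
move=> cf cg; rewrite /rect_int RintegralD//; [exact: measurable_box|..];
  exact: integrable_box.
Qed.

Lemma rect_intZ (c : R) f : continuous f ->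
  rect_int a b (fun x => c * f x) = c * rect_int a b f.
Proof.
move=> cf; rewrite /rect_int RintegralZl//; first exact: measurable_box.
exact: integrable_box.
Qed.

Lemma rect_int_ge0 f : (forall x, 0 <= f x) -> 0 <= rect_int a b f.
Proof. by move=> f0; apply: Rintegral_ge0. Qed.

Lemma rect_int_cst (c : R) : rect_int a b (fun _ => c) = c * rect_measure a b.
Proof.
by rewrite /rect_int (@Rintegral_cst _ _ _ (lebesgue_tuple R d))//;
  exact: measurable_box.
Qed.

Lemma rect_measure_gt0 : 0 < rect_measure a b.
Proof.
rewrite /rect_measure (lebesgue_box ab)/=; apply: prodr_gt0 => i _.
by rewrite subr_gt0.
Qed.

Lemma rect_int_sum (I : eqType) (s : seq I) (f : I -> 'rV[R]_d -> R) :
  (forall i, i \in s -> continuous (f i)) ->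
  rect_int a b (fun x => \sum_(i <- s) f i x) = \sum_(i <- s) rect_int a b (f i).
Proof.
elim: s => [_|i s IHs cf].
  under eq_fun do rewrite big_nil.
  by rewrite rect_int_cst mul0r big_nil.
have cs j : j \in s -> continuous (f j).
  by move=> js; apply: cf; rewrite inE js orbT.
under eq_fun do rewrite big_cons.
rewrite rect_intD//; first by rewrite IHs// big_cons.
  by apply: cf; rewrite mem_head.
exact: continuous_sum.
Qed.

End rect_int_linear.

Section partial_derivatives.
Variables (R : realType) (d : nat).
Implicit Types f g : 'rV[R]_d -> R.

Lemma partial_lin (i : 'I_d) (c e : R) f g x :
  derivable f x (delta_mx 0 i) -> derivable g x (delta_mx 0 i) ->
  derivable (fun x => c * f x + e * g x) x (delta_mx 0 i) /\
  partial i (fun x => c * f x + e * g x) x = c * partial i f x + e * partial i g x.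
Proof.
move=> /derivableP df /derivableP dg.
by have [] := is_deriveD (is_deriveZ c df) (is_deriveZ e dg).
Qed.

Lemma partial_mul (i : 'I_d) f g x :
  derivable f x (delta_mx 0 i) -> derivable g x (delta_mx 0 i) ->
  derivable (fun x => f x * g x) x (delta_mx 0 i) /\
  partial i (fun x => f x * g x) x = partial i f x * g x + f x * partial i g x.
Proof.
move=> /derivableP df /derivableP dg; have [h1 h2] := is_deriveM df dg.
split; first exact: h1.
by rewrite /partial [LHS]h2 /GRing.scale/= addrC (mulrC (g x)).
Qed.

Lemma C2_continuous f : C2 f -> continuous f.
Proof. by case. Qed.

Lemma C2_lin (c e : R) f g : C2 f -> C2 g -> C2 (fun x => c * f x + e * g x).
Proof.
move=> [cf f1 f2] [cg g1 g2].
have P i : partial i (fun x => c * f x + e * g x) =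
    fun x => c * partial i f x + e * partial i g x.
  by apply/funext => x; have [] := partial_lin c e ((f1 i).1 x) ((g1 i).1 x).
split=> [|i|i j].
- by apply: continuous_add; exact: continuous_scale.
- split=> [x|]; first by have [] := partial_lin c e ((f1 i).1 x) ((g1 i).1 x).
  by rewrite P; apply: continuous_add; apply: continuous_scale;
    [exact: (f1 i).2|exact: (g1 i).2].
- have Q x := partial_lin c e ((f2 i j).1 x) ((g2 i j).1 x).
  rewrite P; split=> [x|]; first by have [] := Q x.
  rewrite (_ : partial j _ = fun x => c * partial j (partial i f) x
      + e * partial j (partial i g) x).
    by apply: continuous_add; apply: continuous_scale;
      [exact: (f2 i j).2|exact: (g2 i j).2].
  by apply/funext => x; have [] := Q x.
Qed.

Lemma partial_C2_lin (c e : R) f g i x : C2 f -> C2 g ->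
  partial i (fun x => c * f x + e * g x) x = c * partial i f x + e * partial i g x.
Proof.
move=> [_ f1 _] [_ g1 _].
by have [] := partial_lin c e ((f1 i).1 x) ((g1 i).1 x).
Qed.

Lemma continuous_laplacian f : C2 f -> continuous (laplacian f).
Proof. by move=> [_ _ f2]; apply: continuous_sum => i _; exact: (f2 i i).2. Qed.

Lemma continuous_grad_sqnorm f : C2 f -> continuous (grad_sqnorm f).
Proof.
move=> [_ f1 _]; apply: continuous_sum => i _.
by under eq_fun do rewrite expr2; apply: continuous_mul; exact: (f1 i).2.
Qed.

Variables (a b : 'rV[R]_d).
Hypothesis ab : forall i, a 0 i < b 0 i.

Lemma rect_periodic_lin (c e : R) f g : rect_periodic a b f -> rect_periodic a b g ->
  rect_periodic a b (fun x => c * f x + e * g x).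
Proof. by move=> pf pg i x; rewrite pf pg. Qed.

Lemma rect_periodic_partial f i : rect_periodic a b f ->
  rect_periodic a b (partial i f).
Proof.
move=> pf j x; set p := _ *: _.
have tr (h : R) : h *: delta_mx 0 i + x + p = h *: delta_mx 0 i + (x + p).
  by rewrite addrA.
have [_ H] := @derive_translate R _ _ R^o f (fun y => y + p) x _ _ tr.
by rewrite /partial -H (_ : f \o _ = f)//; apply/funext => y; exact: pf.
Qed.

(** Green's first identity without boundary term: for each [i], the sum of the
two integrands is the [i]-th partial derivative of the periodic function
[partial i f * g]. *)
Lemma rect_int_laplacian_mul f g : C2 f -> C2 g ->
  rect_periodic a b f -> rect_periodic a b g ->
  rect_int a b (fun x => laplacian f x * g x) =
  - rect_int a b (fun x => \sum_(i < d) partial i f x * partial i g x).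
Proof.
move=> [cf f1 f2] [cg g1 _] pf pg.
have cfg i : continuous (fun x => partial i f x * partial i g x).
  by apply: continuous_mul; [exact: (f1 i).2|exact: (g1 i).2].
have clg i : continuous (fun x => partial i (partial i f) x * g x).
  by apply: continuous_mul => //; exact: (f2 i i).2.
apply/eqP; rewrite -addr_eq0 -rect_intD//; last 2 first.
- by apply: continuous_mul => //; apply: continuous_laplacian.
- exact: continuous_sum.
have M i x := partial_mul ((f2 i i).1 x) ((g1 i).1 x).
rewrite (_ : (fun x => _) = fun x =>
    \sum_(i < d) partial i (fun x => partial i f x * g x) x); last first.
  apply/funext => x; rewrite /laplacian mulr_suml -big_split/=.
  by apply: eq_bigr => i _; have [_ ->] := M i x.
have PE i : partial i (fun x => partial i f x * g x) =
    fun x => partial i (partial i f) x * g x + partial i f x * partial i g x.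
  by apply/funext => x; have [_ ->] := M i x.
have cP i : continuous (partial i (fun x => partial i f x * g x)).
  by rewrite PE; exact: continuous_add.
rewrite rect_int_sum// big1// => i _; apply: rect_int_partial_periodic => //.
- by apply: continuous_mul => //; exact: (f1 i).2.
- by move=> x; have [] := M i x.
- by move=> x; rewrite rect_periodic_partial// pg.
Qed.

End partial_derivatives.

(** * Energy dissipation *)

Section energy_law.
Variables (R : realType) (d : nat) (a b : 'rV[R]_d) (eps beta C0 : R).
Hypothesis ab : forall i, a 0 i < b 0 i.
Implicit Types (f g : 'rV[R]_d -> R) (phi : nat -> 'rV[R]_d -> R).

Lemma continuous_SAV_V f : continuous f -> continuous (SAV_V a b beta C0 f).
Proof.
move=> cf; have cc (c : R) : continuous (fun _ : 'rV[R]_d => c).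
  exact: cst_continuous.
apply: continuous_mul => //; apply: continuous_mul => //.
apply: continuous_add => //; apply: continuous_add => //.
by under eq_fun do rewrite expr2; exact: continuous_mul.
Qed.

Lemma continuous_mid phi n : continuous (phi n) -> continuous (phi n.-1) ->
  continuous (fun x => mid (phi ^~ x) n).
Proof.
move=> c1 c2; apply: continuous_mul; last exact: cst_continuous.
exact: continuous_add.
Qed.

Lemma mid_lin phi n :
  (fun x => mid (phi ^~ x) n) = fun x => 2^-1 * phi n x + 2^-1 * phi n.-1 x.
Proof. by apply/funext => x; rewrite /mid; lra. Qed.

Lemma nabla_lin phi n :
  (fun x => nabla (phi ^~ x) n) = fun x => 1 * phi n x + -1 * phi n.-1 x.
Proof. by apply/funext => x; rewrite /nabla; lra. Qed.

Lemma continuous_nabla phi n : continuous (phi n) -> continuous (phi n.-1) ->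
  continuous (fun x => nabla (phi ^~ x) n).
Proof.
by move=> c1 c2; rewrite nabla_lin; apply: continuous_add; exact: continuous_scale.
Qed.

Lemma continuous_SAV_potential phi v fhat n :
  C2 (phi n) -> C2 (phi n.-1) -> continuous fhat ->
  continuous (SAV_potential a b eps beta C0 phi v fhat n).
Proof.
move=> z2 u2 ch; apply: continuous_add; last first.
  by apply: continuous_mul; [exact: continuous_SAV_V|exact: cst_continuous].
apply: continuous_add; apply: continuous_scale.
  by apply: continuous_laplacian; rewrite mid_lin; exact: C2_lin.
by apply: continuous_mid; exact: C2_continuous.
Qed.

(** Crank-Nicolson averages against increments are differences of squares.  The
gradient term is one after Green's identity, and the update of [v] turns the
nonlinear term into [(v n + v n.-1) * nabla v n]. *)
Lemma SAV_energy_increment t phi v fhat n :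
  C2 (phi n) -> C2 (phi n.-1) ->
  rect_periodic a b (phi n) -> rect_periodic a b (phi n.-1) ->
  continuous fhat -> tau t n != 0 ->
  dtau t v n = 2^-1 * rect_int a b (fun x =>
    SAV_V a b beta C0 fhat x * dtau t (phi ^~ x) n) ->
  SAV_energy a b eps beta C0 (phi n) (v n)
  - SAV_energy a b eps beta C0 (phi n.-1) (v n.-1) =
  rect_int a b (fun x =>
    SAV_potential a b eps beta C0 phi v fhat n x * nabla (phi ^~ x) n).
Proof.
move=> z2 u2 zp up ch t0 hv.
set z := phi n in z2 zp *; set u := phi n.-1 in u2 up *.
pose m x := 2^-1 * z x + 2^-1 * u x; pose w x := 1 * z x + -1 * u x.
have mE : (fun x => mid (phi ^~ x) n) = m by exact: mid_lin.
have wE : (fun x => nabla (phi ^~ x) n) = w by exact: nabla_lin.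
have m2 : C2 m by exact: C2_lin.
have w2 : C2 w by exact: C2_lin.
have mp : rect_periodic a b m by exact: rect_periodic_lin.
have wp : rect_periodic a b w by exact: rect_periodic_lin.
have [cz cu cm cw] : [/\ continuous z, continuous u, continuous m & continuous w].
  by split; exact: C2_continuous.
have cV := continuous_SAV_V ch.
set V := SAV_V a b beta C0 fhat in cV hv *.
have hVw : rect_int a b (fun x => V x * w x) = 2 * nabla v n.
  move: hv; rewrite (_ : (fun x => _) = fun x => (tau t n)^-1 * (V x * w x)).
    rewrite rect_intZ//; last exact: continuous_mul.
    by move=> hv; rewrite -[nabla v n](divfK t0) -/(dtau t v n) hv; field.
  by apply/funext => x; rewrite /dtau -wE; ring.
rewrite (_ : (fun x => _ * _) = fun x => - eps ^+ 2 * (laplacian m x * w x)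
    + (beta * (m x * w x) + mid v n * (V x * w x))); last first.
  apply/funext => x; rewrite /SAV_potential mE -wE -/V.
  by rewrite -[mid (phi^~ x) n]/((fun x => mid (phi ^~ x) n) x) mE; ring.
have cmw : continuous (fun x => m x * w x) by exact: continuous_mul.
have cVw : continuous (fun x => V x * w x) by exact: continuous_mul.
have clw : continuous (fun x => laplacian m x * w x).
  by apply: continuous_mul => //; exact: continuous_laplacian.
have cgz := continuous_grad_sqnorm z2; have cgu := continuous_grad_sqnorm u2.
have csq f : continuous f -> continuous (fun x => f x ^+ 2).
  by move=> cf; under eq_fun do rewrite expr2; exact: continuous_mul.
rewrite !rect_intD ?rect_intZ//; do ?[apply: continuous_add];
  do ?[exact: continuous_scale].
rewrite hVw rect_int_laplacian_mul//.
rewrite (_ : (fun x => \sum_(i < d) _) =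
    fun x => 2^-1 * grad_sqnorm z x + (- 2^-1) * grad_sqnorm u x); last first.
  apply/funext => x; rewrite /grad_sqnorm !mulr_sumr -big_split/=.
  by apply: eq_bigr => i _; rewrite !partial_C2_lin//; field.
rewrite (_ : (fun x => m x * w x) =
    fun x => 2^-1 * z x ^+ 2 + (- 2^-1) * u x ^+ 2); last first.
  by apply/funext => x; rewrite /m /w; field.
rewrite /SAV_energy !rect_intD ?rect_intZ//; do ?[exact: csq];
  do ?[apply: continuous_scale => //]; do ?[exact: csq].
by rewrite /mid /nabla; field.
Qed.

End energy_law.

Theorem theorem3p4 (R : realType) (d : nat) (a b : 'rV[R]_d)
    (alpha lambda eps beta C0 T : R) (N : nat) (t : nat -> R)
    (phi : nat -> 'rV[R]_d -> R) (v eta : nat -> R) (phihat1 : 'rV[R]_d -> R) :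
  (0 < d)%N ->
  (forall i, a 0 i < b 0 i) ->
  0 < alpha < 1 -> 0 < lambda -> 0 < eps -> 0 < C0 ->
  time_mesh N T t ->
  (forall n, (n <= N)%N -> C2 (phi n) /\ rect_periodic a b (phi n)) ->
  C2 phihat1 -> rect_periodic a b phihat1 ->
  v 0%N = SAV_aux a b beta C0 (phi 0%N) ->
  (forall n, (1 <= n <= N)%N ->
    let phihat := extrapolation t phihat1 phi n in
    let mu := SAV_potential a b eps beta C0 phi v phihat n in
    [/\ forall x, rect a b x ->
          L1plus alpha t (phi ^~ x) n = - lambda * (mu x - eta n),
        eta n = (rect_measure a b)^-1 * rect_int a b mu &
        dtau t v n =
          2^-1 * rect_int a b (fun x =>
            SAV_V a b beta C0 phihat x * dtau t (phi ^~ x) n)]) ->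
  forall n, (1 <= n <= N)%N ->
    SAV_energy a b eps beta C0 (phi n) (v n)
    - SAV_energy a b eps beta C0 (phi 0%N) (v 0%N) <= 0.

Proof.
move=> d0 ab al01 lam0 eps0 C00 mesh reg ch1 _ v0 scheme n /andP[n0 nN].
have creg m : (m <= N)%N -> continuous (phi m).
  by move=> mN; have [] := reg m mN => /C2_continuous.
pose w m x := nabla (phi ^~ x) m.
pose L m x := L1plus alpha t (phi ^~ x) m.
have cw m : (m <= N)%N -> continuous (w m).
  move=> mN; apply: continuous_nabla; apply: creg => //.
  exact: leq_trans (leq_pred m) mN.
have chat m : (m <= N)%N -> continuous (extrapolation t phihat1 phi m).
  move=> mN; rewrite (_ : extrapolation t phihat1 phi m =
    if (m <= 1)%N then phihat1 else
    fun x => phi m.-1 x + (2 * rho t m.-1)^-1 * w m.-1 x).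
    have m1N := leq_trans (leq_pred m) mN.
    case: ifP => _; first exact: C2_continuous.
    by apply: continuous_add; [exact: creg|apply: continuous_scale; exact: cw].
  by apply/funext => x; rewrite /extrapolation; case: ifP => _ //; rewrite mulrC.
pose mu m := SAV_potential a b eps beta C0 phi v (extrapolation t phihat1 phi m) m.
have cmu m : (0 < m <= N)%N -> continuous (mu m).
  move=> /andP[m0 mN]; have m1N := leq_trans (leq_pred m) mN.
  apply: continuous_SAV_potential; last exact: chat.
    exact: (reg _ mN).1.
  exact: (reg _ m1N).1.
have vol := rect_measure_gt0 ab.
have cL m : (m <= N)%N -> continuous (L m).
  move=> mN; apply: (@continuous_sum _ _ _ _
    (fun k x => L1plus_coef alpha t m k * w k x)) => k.
  rewrite mem_index_iota ltnS => /andP[_ km]; apply: continuous_scale; apply: cw.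
  exact: leq_trans km mN.
have LE m x : (0 < m <= N)%N -> rect a b x -> mu m x = eta m - lambda^-1 * L m x.
  move=> mN bx; have [Lx _ _] := scheme m mN.
  rewrite /L Lx// -/(mu m).
  by rewrite mulrA mulrN mulVf ?gt_eqF// mulN1r opprK addrC subrK.
have intL m : (0 < m <= N)%N -> rect_int a b (L m) = 0.
  move=> mN; have [Lmu etaE _] := scheme m mN; have cm := cmu m mN.
  rewrite (@eq_rect_int _ _ _ _ _ (fun x => - lambda * (mu m x + - eta m)))//.
  rewrite rect_intZ//; last first.
    by apply: continuous_add => //; exact: cst_continuous.
  rewrite rect_intD//; last exact: cst_continuous.
  by rewrite rect_int_cst etaE -/(mu m); field; rewrite gt_eqF.
(* The earlier increments have mean zero, which leaves the diagonal term. *)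
have mass m : (0 < m <= N)%N -> rect_int a b (w m) = 0.
  elim/ltn_ind: m => m IHm mN; have /andP mN' := mN.
  have := intL m mN.
  pose past k x := L1plus_coef alpha t m k * w k x.
  have cpast k : (k <= m)%N -> continuous (past k).
    by move=> km; apply: continuous_scale; apply: cw; exact: leq_trans km mN'.2.
  have cpasts k : k \in index_iota 1 m -> continuous (past k).
    by rewrite mem_index_iota => /andP[_ /ltnW]; exact: cpast.
  rewrite (_ : L m = fun x => \sum_(1 <= k < m) past k x + past m x); last first.
    by apply/funext => x; rewrite /L /L1plus big_nat_recr//=; exact: mN'.1.
  rewrite rect_intD; [|exact: ab|exact: continuous_sum|exact: cpast].
  rewrite rect_int_sum// big_nat big1 ?add0r.
    rewrite rect_intZ//; last by apply: cw; exact: mN'.2.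
    move=> /eqP; rewrite mulf_eq0 gt_eqF/=; last first.
      exact: (L1plus_coef_diag_gt0 al01 mesh mN).
    by move/eqP.
  move=> k /andP[k0 km]; have kN := leq_trans (ltnW km) mN'.2.
  rewrite rect_intZ//; last exact: cw.
  by rewrite IHm ?mulr0// k0.
pose E m := SAV_energy a b eps beta C0 (phi m) (v m).
(* On the box, [mu m] is [eta m - lambda^-1 * L m]; the constant [eta m] is
   integrated against an increment of mean zero. *)
have incr m : (0 < m <= N)%N -> E m - E m.-1 =
    - lambda^-1 * rect_int a b (fun x => w m x * L m x).
  move=> mN; have /andP[m0 mN'] := mN; have m1N := leq_trans (leq_pred m) mN'.
  have [_ _ hv] := scheme m mN.
  have [z2 zp] := reg _ mN'; have [u2 up] := reg _ m1N.
  rewrite /E (@SAV_energy_increment _ _ _ _ eps beta C0 ab t phi v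
    (extrapolation t phihat1 phi m) m)//.
  - rewrite (@eq_rect_int _ _ _ _ _
      (fun x => eta m * w m x + - lambda^-1 * (w m x * L m x))); last first.
      by move=> x bx; rewrite -/(mu m) LE// /w; ring.
    have cwL : continuous (fun x => w m x * L m x).
      by apply: continuous_mul; [exact: cw|exact: cL].
    rewrite rect_intD//; last 2 first.
      by apply: continuous_scale; exact: cw.
      exact: continuous_scale.
    by rewrite !rect_intZ ?mass ?mulr0 ?add0r//; exact: cw.
  - exact: chat.
  - by rewrite gt_eqF//; exact: (tau_gt0 mesh mN).
have tele : E n - E 0%N = \sum_(1 <= m < n.+1) (E m - E m.-1).
  by rewrite -(telescope_sumr E (leq0n n)) [RHS]big_add1.
rewrite -/(E n) -/(E 0%N) tele.
rewrite big_nat (eq_bigr (fun m => - lambda^-1 *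
  rect_int a b (fun x => w m x * L m x))); last first.
  move=> m /andP[m0 mn]; have mN : (m <= N)%N by rewrite (leq_trans _ nN).
  by rewrite incr ?m0.
rewrite -big_nat -mulr_sumr mulNr oppr_le0 mulr_ge0 ?invr_ge0//; first exact: ltW.
rewrite -rect_int_sum//.
  by apply: rect_int_ge0 => x; exact: (L1plus_form_ge0 al01 mesh (phi ^~ x) nN).
move=> m; rewrite mem_index_iota => /andP[_ mn].
by apply: continuous_mul; [apply: cw|apply: cL]; rewrite (leq_trans _ nN).
Qed.
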